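(* Let $F$ be a 3-CNF formula on $n$ variables that has no satisfying assignment of Hamming weight less than $n/2$, and suppose that $F$ is negation closed, meaning that whenever an assignment $\alpha$ satisfies $F$, the assignment obtained from $\alpha$ by negating every bit also satisfies $F$. Then the number of satisfying assignments of $F$ of Hamming weight exactly $n/2$ is at most $6^{n/4}$.
   Context: A 3-CNF is a conjunction of clauses, each a disjunction of at most 3 literals. The Hamming weight of a 0/1 assignment is the number of variables set to 1. *)

(* Defs.v *)
From mathcomp Require Import all_boot.

Set Implicit Arguments.
Unset Strict Implicit.
Unset Printing Implicit Defensive.

Notation assignment n := {ffun 'I_n -> bool}.

Section CNF.
Variable n : nat.

(* (i, true) is the literal x_i and (i, false) is the literal ~ x_i. *)
Definition literal : Type := ('I_n * bool)%type.

(* The disjunction of its literals; the empty clause is false. *)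
Definition clause : Type := seq literal.

(* The conjunction of its clauses; the empty formula is true. *)
Definition cnf : Type := seq clause.

Definition lit_true (a : assignment n) (l : literal) : bool := a l.1 == l.2.

Definition satisfies (a : assignment n) (F : cnf) : bool :=
  all (has (lit_true a)) F.

Definition is_kcnf (k : nat) (F : cnf) : bool :=
  all (fun C : clause => size C <= k) F.

Definition hamming_weight (a : assignment n) : nat := #|[set i | a i]|.

Definition negate (a : assignment n) : assignment n := [ffun i => ~~ a i].

Definition negation_closed (F : cnf) : Prop :=
  forall a : assignment n, satisfies a F -> satisfies (negate a) F.

End CNF.

(* Main.v *)
Require Import Defs.
From mathcomp Require Import all_boot all_order all_algebra.
From mathcomp Require Import reals exp.
From mathcomp Require Import zify ring lra.

(** Since [F] is negation closed and has no light model, every model has weight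
exactly [h = n/2]. Think of models as sets; their family [S] is closed under
complement, and whenever [A] (ones) and [B] (zeros) are disjoint with [|A| < h],
the zero extension of [A] falsifies a clause, so some set of at most three
undecided variables meets every model extending [(A, B)]; such a set of size
three meets every model, hence (by complement) contains none.

One branches on these hitting sets. Branching on [T] with the child "[v] is one"
shares a model having two ones in [T] equally between two children: the other
members of [T] become _half_ variables, whose value one costs a factor [1/2].
Deciding a one costs [1/2], and deciding a zero or making a fresh variable half
costs [q = sqrt (2/3)]; since [2/q = sqrt 6], every branching whose total cost is
at most one is compatible with the bound [6^(n/4)]. A fresh triple costs
[3 * q^2 / 2 = 1]. The only unfavourable hitting sets consist of a half variable
and two fresh ones, of cost [kappa = 5q/4 > 1]. These are compensated as follows.
Take a maximal family of disjoint fresh triples; all pairs [e] in question then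
lie outside it, with labels [v] (such that [v |: e] is a triple) inside it, and
one processes a maximum matching of them. If all labels of [e] are chosen to be
one, [e] becomes a link: its two members are not both one, which saves a factor;
if at least two labels are half, a direct branching saves the same factor.
Averaged over the choices in the triples this beats the cost [kappa], provided
that no variable labels more than four matched pairs. The latter may be assumed,
because a variable with six disjoint pairs in its link is cheap to decide. *)

Set Implicit Arguments.
Unset Strict Implicit.
Unset Printing Implicit Defensive.
Import Order.TTheory GRing.Theory Num.Theory.
Local Open Scope ring_scope.

(** * Numerical inequalities between the branching costs *)

Section Constants.
Variables (R : realFieldType) (q : R).
Hypotheses (q_gt0 : 0 < q) (qq : q * q = 2 / 3).

(** Both fractions lie within 2/10^5 of sqrt (2/3), which is precise enough for [lra] to settle the
    tight inequalities below. *)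
Lemma q_bounds : 218 / 267 <= q <= 485 / 594.
Proof.
have sq (x y : R) : 0 <= x -> 0 <= y -> x * x <= y * y -> x <= y.
  by move=> x0 y0; rewrite -!expr2 ler_sqr ?nnegrE.
by apply/andP; split; apply: sq; rewrite ?qq ?(ltW q_gt0) //; lra.
Qed.

Lemma qV : q^-1 = 3 / 2 * q.
Proof. apply: (mulfI (lt0r_neq0 q_gt0)); rewrite divff ?lt0r_neq0 // mulrCA qq; lra. Qed.

Lemma q_le1 : q <= 1.
Proof. by have /andP[_ ] := q_bounds; lra. Qed.

(* [kappa] is the cost of a hitting set with one half and two fresh variables;
   [rho] is the factor of a linked pair, and also of a pair with two half labels.
   The needed bounds are [3/4 * q + 1/3 <= rho] and [rho^8 + 2 * kappa^8 <= 3]. *)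
Definition kappa : R := 5 / 4 * q.
Definition rho : R := 473 / 500.
(** The ratio [rho / kappa]: the saving due to one link, or to one pair with two half labels. *)
Definition theta : R := 1419 / 1250 * q.

Lemma kappa_theta : kappa * theta = rho.
Proof. rewrite /kappa /theta /rho; rewrite mulrACA qq; lra. Qed.

Lemma kappa_ge1 : 1 <= kappa.
Proof. by rewrite /kappa; have /andP[] := q_bounds; lra. Qed.

Lemma theta_gt0 : 0 < theta.
Proof. by rewrite /theta; have := q_gt0; lra. Qed.

Lemma theta_le1 : theta <= 1.
Proof. by rewrite /theta; have /andP[] := q_bounds; lra. Qed.

Lemma qq_le_theta : q ^+ 2 <= theta.
Proof. by rewrite expr2 qq /theta; have /andP[] := q_bounds; lra. Qed.

(** Deciding a variable with six disjoint pairs in its link: value one costs 1/2, value zero costs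
    [q] and then [2^-1 + q / 2] for each pair. Five pairs would not suffice. *)
Lemma star_cost : q * (2^-1 + q / 2) ^+ 6 <= 2^-1.
Proof.
have /andP[_ h] := q_bounds.
have h1 : 2^-1 + q / 2 <= 109 / 120 by lra.
have h0 : 0 <= 2^-1 + q / 2 by have := q_gt0; lra.
apply: (@le_trans _ _ (485 / 594 * (109 / 120) ^+ 6)); last by rewrite !exprS expr0; lra.
apply: ler_pM => //; [exact: ltW|exact: exprn_ge0|].
by rewrite lerXn2r // nnegrE; lra.
Qed.

Lemma star_pow n : (6 <= n)%N -> (2^-1 + q / 2) ^+ n <= (2^-1 + q / 2) ^+ 6.
Proof.
by have := q_gt0; have := q_le1 => h1 h0 n6; apply: ler_wiXn2l => //; lra.
Qed.

(** The total cost of the three children in [Z_double]: two of cost [q / 2], and one of cost 1/16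
    that may lose the saving [theta] of six further pairs. *)
Lemma double_pair_cost : q + (16 * theta ^+ 6)^-1 <= rho.
Proof.
have -> : theta ^+ 6 = (1419 / 1250) ^+ 6 * (8 / 27).
  by rewrite /theta exprMn; congr (_ * _); rewrite (exprM q 2 3) expr2 qq !exprS expr0; lra.
have /andP[_ h] := q_bounds.
rewrite /rho.
suff : (16 * ((1419 / 1250) ^+ 6 * (8 / 27)))^-1 <= 11/100 :> R by lra.
rewrite !exprS expr0 -[leRHS]invrK lef_pV2 ?posrE; lra.
Qed.

Let qd k : q ^+ k.+1 / q = q ^+ k.
Proof. by rewrite exprSr mulfK // lt0r_neq0. Qed.

Let hqd k : 2^-1 * q ^+ k.+1 / q = 2^-1 * q ^+ k.
Proof. by rewrite -[LHS]mulrA qd. Qed.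

Lemma half_cube : 2^-1 * q ^+ 3 / q = 3^-1.
Proof. by rewrite hqd expr2 qq; lra. Qed.

(** In this and the next lemmas [k] counts the half members of a hitting set. Their outer factor 1/2
    is the coefficient in [Z_branch]; the rest is the ratio of budgets in [budget_child]. *)
Lemma no_fresh_cost (k : nat) : (k <= 3)%N -> (2^-1 * (2^-1 * q ^+ 0 / q)) *+ k <= 1.
Proof.
move=> k3; have h : 2^-1 * (2^-1 * q ^+ 0 / q) = 3 / 8 * q by rewrite expr0 qV; lra.
have := q_gt0; have := q_le1; rewrite h => h1 h0.
apply: (@le_trans _ _ ((3 / 8 * q) *+ 3)); last first.
  by have /andP[_ h2] := q_bounds; lra.
by rewrite ler_wpMn2l //; lra.
Qed.

(** The flag [p] tells whether the fresh variable is linked. If so, its partner becomes zero, which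
    contributes another [q]; the link is used up, so the cost must be at most [theta]. *)
Lemma one_fresh_cost (k : nat) (p : bool) : (k <= 2)%N ->
  (2^-1 * (2^-1 * q ^+ 1 / q)) *+ k + 2^-1 * q ^+ p.+1 / q <= theta ^+ p.
Proof.
move=> k2; have -> : 2^-1 * (2^-1 * q ^+ 1 / q) = 4^-1 by rewrite hqd expr0; lra.
apply: (@le_trans _ _ (2^-1 + 2^-1 * q ^+ p.+1 / q)).
  rewrite lerD2r; apply: (@le_trans _ _ (4^-1 *+ 2)); last by lra.
  by rewrite ler_wpMn2l // invr_ge0.
rewrite hqd; case: p => /=; rewrite ?expr0 ?expr1; last by lra.
by rewrite /theta; have /andP[h1 h2] := q_bounds; lra.
Qed.

Lemma two_fresh_cost (k : nat) (p1 p2 : bool) : (k <= 1)%N ->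
  (2^-1 * (2^-1 * q ^+ 2 / q)) *+ k +
    (2^-1 * q ^+ p1.+2 / q + 2^-1 * q ^+ p2.+2 / q) <= kappa ^+ k * theta ^+ (p1 + p2).
Proof.
move=> k1; have -> : 2^-1 * (2^-1 * q ^+ 2 / q) = 4^-1 * q by rewrite hqd expr1; lra.
rewrite !hqd; have /andP[h1 h2] := q_bounds.
have e2 : q ^+ 2 = 2 / 3 by rewrite expr2 qq.
have etheta : theta ^+ 2 = (1419 / 1250) ^+ 2 * (2 / 3) by rewrite exprMn e2.
case: k k1 => [|[|//]] _; rewrite ?mulr0n ?mulr1n ?expr0 ?expr1 ?mul1r ?add0r;
case: p1; case: p2 => /=; rewrite ?addn0 ?addn1 ?addSn ?addn0 ?expr0 ?expr1 ?mulr1 ?kappa_theta ?e2 ?etheta.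
- rewrite !expr2; lra.
- by rewrite /theta; lra.
- by rewrite /theta; lra.
- lra.
- rewrite /kappa !expr2; lra.
- rewrite /rho; lra.
- rewrite /rho; lra.
- rewrite /kappa; lra.
Qed.

(** The hitting set is itself a link: no partner outside it is forced, but only one link is used
    up. *)
Lemma linked_pair_cost : 2^-1 * q ^+ 2 / q + 2^-1 * q ^+ 2 / q <= theta.
Proof. by rewrite !hqd expr1 /theta; have := q_gt0; lra. Qed.

Let kappa2 : kappa ^+ 2 = 25 / 24.
Proof. rewrite /kappa expr2 mulrACA qq; lra. Qed.

Let kappa_le : kappa <= 49 / 48.
Proof. by rewrite /kappa; have /andP[] := q_bounds; lra. Qed.

Let kappa_gt0 : 0 < kappa.
Proof. exact: lt_le_trans kappa_ge1. Qed.

Lemma rho_gt0 : 0 < rho.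
Proof. by rewrite /rho; lra. Qed.

Let rho_pos : 0 < rho := rho_gt0.

Lemma rho_le1 : rho <= 1.
Proof. by rewrite /rho; lra. Qed.

Let rho2 : rho ^+ 2 <= 179 / 200.
Proof. by rewrite /rho expr2; lra. Qed.

Let kappaX (k : nat) : (kappa ^+ k.*2 = (25 / 24) ^+ k) * (kappa ^+ k.*2.+1 <= (25 / 24) ^+ k * (49 / 48)).
Proof.
have e : kappa ^+ k.*2 = (25 / 24) ^+ k by rewrite -muln2 mulnC exprM kappa2.
split=> //; rewrite exprSr e ler_pM2l //; apply: exprn_gt0; lra.
Qed.

Let rhoX (k : nat) : (rho ^+ k.*2 <= (179 / 200) ^+ k) * (rho ^+ k.*2.+1 <= (179 / 200) ^+ k * rho).
Proof.
have e : rho ^+ k.*2 <= (179 / 200) ^+ k.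
  by rewrite -muln2 mulnC exprM lerXn2r ?nnegrE ?exprn_ge0 ?(ltW rho_gt0) //; lra.
by split=> //; rewrite exprSr ler_pM2r.
Qed.

(** At [a = 8] the first sum misses 3 by less than 1/200, and at [a = 9] it exceeds 3; hence the
    need to limit how many pairs a variable labels. *)
Lemma alpha_cost (a : nat) : (a <= 8)%N ->
  [/\ rho ^+ a + kappa ^+ a * 2 <= 3, rho ^+ a * kappa + kappa ^+ a * rho <= 2
    & rho ^+ a * kappa + kappa ^+ a * rho * 3 <= 4].
Proof.
rewrite -(odd_double_half a); move: (odd a) (a./2) => b k.
have hc := kappa_le; have hc0 := kappa_ge1.
have rho0 (x : R) : x * rho = x * (473 / 500) by [].
have step (x y u v : R) : 0 <= x -> 0 <= y -> x <= u -> y <= v ->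
    [/\ u + v * 2 <= 3, u * (49 / 48) + v * (473 / 500) <= 2 &
     u * (49 / 48) + v * (473 / 500) * 3 <= 4] ->
    [/\ x + y * 2 <= 3, x * kappa + y * rho <= 2 & x * kappa + y * rho * 3 <= 4].
  move=> x0 y0 xu yv [h1 h2 h3].
  have : x * kappa <= u * (49 / 48) by apply: ler_pM => //; lra.
  by rewrite /rho; split; lra.
case: b => /= kle; rewrite ?add0n ?add1n.
  apply: step (rhoX k).2 (kappaX k).2 _; rewrite ?exprn_ge0 ?(ltW rho_gt0) ?(ltW kappa_gt0) //.
  by case: k kle => [|[|[|[|k]]]] // _; rewrite /rho ?exprS ?expr0; split; lra.
apply: step (rhoX k).1 (lexx _) _; rewrite ?exprn_ge0 ?(ltW rho_gt0) ?(ltW kappa_gt0) // kappaX.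
by case: k kle => [|[|[|[|[|k]]]]] // _; rewrite ?exprS ?expr0; split; lra.
Qed.

Let kappa_rho : kappa * rho <= 1.
Proof. by have := kappa_le; rewrite /rho; lra. Qed.

(** Lowering both exponents by one divides both terms by [kappa * rho <= 1], so the case [b = 0],
    which is [alpha_cost], and the case [a = 0] suffice. *)
Lemma beta_cost (a b : nat) : (a <= 8)%N -> (b <= 3)%N ->
  rho ^+ a * kappa ^+ b.+1 + kappa ^+ a * rho ^+ b.+1 <= 2 /\
  rho ^+ a * kappa ^+ b.+1 + kappa ^+ a * rho ^+ b.+1 * 3 <= 4.
Proof.
have r0 := rho_gt0; have c0 := kappa_gt0.
elim: b a => [|b IH] a a8 b3; first by have [] := alpha_cost a8; rewrite !expr1.
have b3' : (b <= 3)%N by lia.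
case: a a8 => [|a] a8.
  have [h1 h2] := IH 0%N isT b3'; have hr : rho <= 1 by rewrite /rho; lra.
  rewrite !expr0 !mul1r in h1 h2 *.
  have hb : rho ^+ b.+2 <= rho ^+ 2 by rewrite ler_wiXn2l // ltW.
  have hc : kappa ^+ b.+2 <= (25 / 24) ^+ 2.
    by rewrite -(kappaX 2).1 ler_weXn2l ?kappa_ge1.
  by have := rho2; move: hb hc; rewrite (expr2 (25 / 24)); split; lra.
have [h1 h2] := IH a (ltnW a8) b3'.
set P := rho ^+ a * kappa ^+ b.+1 in h1 h2; set U := kappa ^+ a * rho ^+ b.+1 in h1 h2.
have -> : rho ^+ a.+1 * kappa ^+ b.+2 = (kappa * rho) * P by rewrite (exprS rho a) (exprS kappa b.+1) /P; ring.
have -> : kappa ^+ a.+1 * rho ^+ b.+2 = (kappa * rho) * U by rewrite (exprS kappa a) (exprS rho b.+1) /U; ring.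
have P0 : 0 <= P by rewrite /P mulr_ge0 // exprn_ge0 // ltW.
have U0 : 0 <= U by rewrite /U mulr_ge0 // exprn_ge0 // ltW.
have hP : kappa * rho * P <= P by rewrite ler_piMl.
have hU : kappa * rho * U <= U by rewrite ler_piMl.
by split; lra.
Qed.
(** The claim is linear in [Q] and [T], so only the extreme ratios [T = Q] and [T = 3 * Q] matter;
    they are the last two hypotheses. *)
Let elim_beta (p u Q T : R) : 0 <= Q -> Q <= T -> T <= 3 * Q -> p + u <= 2 -> p + u * 3 <= 4 ->
  p * Q + u * T <= Q + T.
Proof.
move=> Q0 QT T3 h1 h2.
have [u1|u1] := leP u 1.
  have : 0 <= (1 - u) * (T - Q) by rewrite mulr_ge0 // subr_ge0.
  have : 0 <= (2 - p - u) * Q by rewrite mulr_ge0 //; lra.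
  lra.
have : 0 <= (u - 1) * (3 * Q - T) by rewrite mulr_ge0; lra.
have : 0 <= (4 - p - u * 3) * Q by rewrite mulr_ge0 //; lra.
lra.
Qed.

(** Again by linearity, now with the extreme cases [T = 0] and [T = 2 * Q]. *)
Let elim_alpha (p u Q T : R) : 0 <= Q -> 0 <= T -> T <= 2 * Q -> p <= 1 -> p + u * 2 <= 3 ->
  p * Q + u * T <= Q + T.
Proof.
move=> Q0 T0 T2 h1 h2.
have : 0 <= (1 - p) * Q by rewrite mulr_ge0 // subr_ge0.
have [u1|u1] := leP u 1.
  have : 0 <= (1 - u) * T by rewrite mulr_ge0 // subr_ge0.
  lra.
have : 0 <= (u - 1) * (2 * Q - T) by rewrite mulr_ge0; lra.
have : 0 <= (3 - p - u * 2) * Q by rewrite mulr_ge0 //; lra.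
lra.
Qed.

(* In [triple_choice_cost] the three products are the factors of the pairs
   labelled by a triple, one product for each choice in the triple. *)
Definition pw (a b : nat) := rho ^+ a * kappa ^+ b.
Definition uw (a b : nat) := kappa ^+ a * rho ^+ b.

Let rhoE n : rho ^+ n = kappa ^+ n * theta ^+ n.
Proof. by rewrite -exprMn kappa_theta. Qed.

Let theta2 : theta ^+ 2 = (1419 / 1250) ^+ 2 * (2 / 3).
Proof. by rewrite /theta exprMn expr2 [q ^+ 2]expr2 qq. Qed.

Let pw_gt0 a b : 0 < pw a b. Proof. by rewrite mulr_gt0 ?exprn_gt0. Qed.
Let uw_gt0 a b : 0 < uw a b. Proof. by rewrite mulr_gt0 ?exprn_gt0. Qed.

Let theta_pow k n : (k <= n.*2)%N -> ((1419 / 1250) ^+ 2 * (2 / 3)) ^+ n <= theta ^+ k.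
Proof.
move=> kn; rewrite -theta2 -exprM mul2n ler_wiXn2l ?(ltW theta_gt0) ?theta_le1 //.
Qed.

(** Since [rho = kappa * theta], the ratio of [pw a b] to [uw a b] is [theta ^+ a / theta ^+ b]; the
    claim reduces to [theta ^+ 8 >= 1/2], and [pu_high] to [theta ^+ 4 >= 2/3]. *)
Let pu_low a b : (a <= 8)%N -> uw a b <= 2 * pw a b.
Proof.
move=> a8; rewrite /pw /uw [rho ^+ a]rhoE.
have h : 2^-1 <= theta ^+ a by apply: le_trans (theta_pow (n := 4) a8); rewrite !exprS !expr0; lra.
rewrite -mulrA mulrCA ler_pM2l ?exprn_gt0 //.
have : rho ^+ b <= kappa ^+ b.
  by rewrite lerXn2r ?nnegrE ?ltW //; apply: lt_le_trans kappa_ge1; rewrite /rho; lra.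
have : 0 < kappa ^+ b by rewrite exprn_gt0.
move: (theta ^+ a) (kappa ^+ b) h => x y h y0 h1.
have : 0 <= (x - 2^-1) * y by rewrite mulr_ge0 ?subr_ge0 // ltW.
lra.
Qed.

Let pu_high a b : (b <= 4)%N -> pw a b <= 3 / 2 * uw a b.
Proof.
move=> b4; rewrite /pw /uw [rho ^+ b]rhoE.
have h : 2 / 3 <= theta ^+ b by apply: le_trans (theta_pow (n := 2) b4); rewrite !exprS !expr0; lra.
rewrite mulrCA [_ ^+ a * _]mulrC [leRHS]mulrA [leRHS]mulrC mulrA.
have : rho ^+ a <= kappa ^+ a.
  by rewrite lerXn2r ?nnegrE ?ltW //; apply: lt_le_trans kappa_ge1; rewrite /rho; lra.
have c0 : 0 < kappa ^+ a by rewrite exprn_gt0.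
have c1 : 0 < kappa ^+ b by rewrite exprn_gt0.
have {h} : 1 <= 3 / 2 * theta ^+ b by lra.
move=> h h1; rewrite -[X in X <= _]mulr1 mulrAC [leRHS](_ : _ = kappa ^+ a * kappa ^+ b * (3 / 2 * theta ^+ b)); last by ring.
rewrite mulr1 mulrC.
apply: (@le_trans _ _ (kappa ^+ a * kappa ^+ b)); first by rewrite ler_pM2r.
by rewrite ler_peMr // mulr_ge0 ?ltW.
Qed.

(** The sum does not decrease when a positive [b] is set to zero together with its [a]. Once all [b]
    vanish, the [a] can be set to zero one by one, and the sum at zero is 3. *)
Lemma triple_choice_cost (a1 a2 a3 b1 b2 b3 : nat) :
  (a1 <= 8)%N -> (a2 <= 8)%N -> (a3 <= 8)%N -> (b1 <= 4)%N -> (b2 <= 4)%N -> (b3 <= 4)%N ->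
  pw a1 b1 * uw a2 b2 * uw a3 b3 + uw a1 b1 * pw a2 b2 * uw a3 b3 +
  uw a1 b1 * uw a2 b2 * pw a3 b3 <= 3.
Proof.
pose F a1 b1 a2 b2 a3 b3 := pw a1 b1 * uw a2 b2 * uw a3 b3 + uw a1 b1 * pw a2 b2 * uw a3 b3 +
  uw a1 b1 * uw a2 b2 * pw a3 b3.
have Frot x1 y1 x2 y2 x3 y3 : F x1 y1 x2 y2 x3 y3 = F x2 y2 x3 y3 x1 y1.
  by rewrite /F; ring.
have Fsplit x1 y1 x2 y2 x3 y3 : F x1 y1 x2 y2 x3 y3 =
    pw x1 y1 * (uw x2 y2 * uw x3 y3) +
    uw x1 y1 * (pw x2 y2 * uw x3 y3 + uw x2 y2 * pw x3 y3).
  rewrite /F; move: (pw x1 y1) (pw x2 y2) (pw x3 y3) (uw x1 y1) (uw x2 y2) (uw x3 y3).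
  by move=> *; ring.
have E0 : (pw 0 0 = 1) * (uw 0 0 = 1) by rewrite /pw /uw !expr0 mulr1.
have beta x1 y1 x2 y2 x3 y3 : (x1 <= 8)%N -> (x2 <= 8)%N -> (x3 <= 8)%N ->
    (0 < y1 <= 4)%N -> (y2 <= 4)%N -> (y3 <= 4)%N ->
    F x1 y1 x2 y2 x3 y3 <= F 0 0 x2 y2 x3 y3.
  case: y1 => // y1 h1 h2 h3 k1 k2 k3.
  have [e1 e2] := beta_cost h1 k1.
  rewrite !Fsplit !E0 !mul1r.
  rewrite -/(pw _ _) -/(uw _ _) in e1 e2; have l2 := pu_low y2 h2; have l3 := pu_low y3 h3.
  have g2 := pu_high x2 k2; have g3 := pu_high x3 k3.
  have := uw_gt0 x2 y2; have := uw_gt0 x3 y3.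
  move: (pw x2 y2) (uw x2 y2) (pw x3 y3) (uw x3 y3) l2 l3 g2 g3 => p u p' u' l2 l3 g2 g3 u'0 u0.
  apply: elim_beta => //; first by rewrite mulr_ge0 ?ltW.
  - have : 0 <= (2 * p - u) * u' by rewrite mulr_ge0 ?subr_ge0 // ltW.
    have : 0 <= (2 * p' - u') * u by rewrite mulr_ge0 ?subr_ge0 // ltW.
    lra.
  have : 0 <= (3 / 2 * u - p) * u' by rewrite mulr_ge0 ?subr_ge0 // ltW.
  have : 0 <= (3 / 2 * u' - p') * u by rewrite mulr_ge0 ?subr_ge0 // ltW.
  lra.
have alpha x1 x2 x3 : (x1 <= 8)%N -> F x1 0 x2 0 x3 0 <= F 0 0 x2 0 x3 0.
  move=> h1; have [e1 _ _] := alpha_cost h1.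
  have h0 x : pw x 0 <= 1.
    by rewrite /pw expr0 mulr1 exprn_ile1 ?(ltW rho_gt0) //; rewrite /rho; lra.
  have hu x : 1 <= uw x 0 by rewrite /uw expr0 mulr1 exprn_ege1 ?kappa_ge1.
  rewrite !Fsplit !E0 !mul1r.
  have := uw_gt0 x2 0; have := uw_gt0 x3 0; have := pw_gt0 x2 0; have := pw_gt0 x3 0.
  have := le_trans (h0 x2) (hu x2); have := le_trans (h0 x3) (hu x3).
  move: (pw x2 0) (uw x2 0) (pw x3 0) (uw x3 0) => p u p' u' g2 g3 p'0 p0 u'0 u0.
  have Q0 : 0 <= u * u' by rewrite mulr_ge0 ?ltW.
  have T0 : 0 <= p * u' + u * p' by rewrite addr_ge0 ?mulr_ge0 ?ltW.
  apply: elim_alpha => //; last by rewrite /pw /uw !expr0 !mulr1.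
  have : 0 <= (u - p) * u' by rewrite mulr_ge0 ?subr_ge0 // ltW.
  have : 0 <= (u' - p') * u by rewrite mulr_ge0 ?subr_ge0 // ltW.
  lra.
have killb x1 y1 x2 y2 x3 y3 : (x1 <= 8)%N -> (x2 <= 8)%N -> (x3 <= 8)%N ->
    (y1 <= 4)%N -> (y2 <= 4)%N -> (y3 <= 4)%N ->
    exists2 z, (z <= 8)%N & F x1 y1 x2 y2 x3 y3 <= F z 0%N x2 y2 x3 y3.
  move=> h1 h2 h3 k1 k2 k3; case: (posnP y1) => [->|y0]; first by exists x1.
  by exists 0%N => //; apply: beta; rewrite ?y0.
move=> h1 h2 h3 k1 k2 k3; rewrite -/(F a1 b1 a2 b2 a3 b3).
have [z1 {}h1 e1] := killb _ _ _ _ _ _ h1 h2 h3 k1 k2 k3.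
have [z2 {}h2 e2] := killb _ _ _ _ _ _ h2 h3 h1 k2 k3 (leq0n 4).
have [z3 {}h3 e3] := killb _ _ _ _ _ _ h3 h1 h2 k3 (leq0n 4) (leq0n 4).
apply: (le_trans e1); rewrite Frot; apply: (le_trans e2); rewrite Frot; apply: (le_trans e3).
apply: (le_trans (alpha _ _ _ h3)); rewrite Frot.
apply: (le_trans (alpha _ _ _ h1)); rewrite Frot.
apply: (le_trans (alpha _ _ _ h2)); rewrite /F !E0; lra.
Qed.
End Constants.

(** * Averaging over the three choices in a triple *)

Section Choice.
Variables (V : finType) (R : realFieldType) (q : R).
Hypotheses (q_gt0 : 0 < q) (qq : q * q = 2 / 3).
Local Notation kappa := (kappa q).
Local Notation rho := (rho R).

(* Over the three choices in [T], an index whose last undecided labels lie in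
   [T] follows one of the patterns (rho, kappa, kappa), (kappa, rho, rho) (up to the order
   of [T]) or is constantly [rho]; [a] and [b] count the first two. *)
Lemma choice_sum (J : finType) (La : {set J}) (lab : J -> {set V}) (hc : J -> nat) (T : {set V}) :
  #|T| = 3%N -> (forall j, j \in La -> ~~ [disjoint lab j & T]) ->
  (forall v, v \in T -> (#|[set j in La | v \in lab j]| <= 4)%N) ->
  \sum_(v in T) \prod_(j in La) (if (hc j + #|lab j :&: (T :\ v)| == 1)%N then kappa else rho) <= 3.
Proof.
move=> T3 Lne L4.
have c1 := kappa_ge1 q_gt0 qq; have c0 : 0 < kappa by apply: lt_le_trans c1.
have r0 : 0 < rho := rho_gt0 R; have r1 : rho <= 1 := rho_le1 R.
have [x xT] : exists x, x \in T by apply/card_gt0P; rewrite T3.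
have /cards2P[y [z [yz Tx]]] : #|T :\ x| == 2%N.
  by move: T3; rewrite (cardsD1 x) xT add1n => -[->].
have TE : T = [set x; y; z] by rewrite -setUA -Tx setD1K.
have [xy xz] : x != y /\ x != z.
  by split; [have /setP/(_ y) := Tx|have /setP/(_ z) := Tx]; rewrite !inE eqxx ?orbT eq_sym => /andP[].
(* [al]: no half label so far, and the labels in [T] are the distinguished variable alone or exactly
   the other two. [be]: one half label so far, and the only label in [T] is the distinguished
   variable. All other cases give [rho] for every choice. *)
pose al (bx b1 b2 : bool) (k : nat) : bool := [&& k == 0%N, bx != b1 & b1 == b2].
pose be (bx b1 b2 : bool) (k : nat) : bool := [&& k == 1%N, bx, ~~ b1 & ~~ b2].
pose a u v w := (\sum_(j in La) al (u \in lab j) (v \in lab j) (w \in lab j) (hc j))%N.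
pose b u v w := (\sum_(j in La) be (u \in lab j) (v \in lab j) (w \in lab j) (hc j))%N.
have deg u : (\sum_(j in La) (u \in lab j : nat))%N = #|[set j in La | u \in lab j]|.
  rewrite -sum1_card big_mkcond [RHS]big_mkcond /=; apply: eq_bigr => j _.
  by rewrite inE; case: (j \in La) => //; case: (u \in lab j).
have b4 u v w : u \in T -> (b u v w <= 4)%N.
  move=> uT; apply: leq_trans (L4 u uT); rewrite -deg; apply: leq_sum => j _.
  by rewrite /be; case: (u \in lab j); rewrite ?andbF //=; case: (_ && _).
(* The labels in [T] of an index counted by [a u v w] are [u] alone or [v] and [w], so [u] or [v]
   labels it. *)
have a8 u v w : u \in T -> v \in T -> (a u v w <= 8)%N.
  move=> uT vT; apply: leq_trans (leq_add (L4 u uT) (L4 v vT)); rewrite -!deg -big_split /=.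
  apply: leq_sum => j _; rewrite /al.
  by case: (u \in lab j); case: (v \in lab j); case: (w \in lab j); case: (hc j).
have key u v w : T = [set u; v; w] -> u != v -> u != w -> v != w ->
    \prod_(j in La) (if (hc j + #|lab j :&: (T :\ u)| == 1)%N then kappa else rho) <=
    (rho ^+ a u v w * kappa ^+ b u v w) * (kappa ^+ a v u w * rho ^+ b v u w) *
    (kappa ^+ a w u v * rho ^+ b w u v).
  move=> Te uv uw vw; rewrite /a /b -!prodrXr -!big_split /=; apply: ler_prod => j jL.
  have card2 : #|lab j :&: (T :\ u)| = ((v \in lab j) + (w \in lab j))%N.
    have -> : T :\ u = [set v; w].
      apply/setP => t; rewrite Te !inE; case: (t =P u) => [->|_] //=.
      by rewrite (negPf uv) (negPf uw).
    rewrite -sum1_card (eq_bigl (fun t => (t \in [set v; w]) && (t \in lab j))) => [|t]; last first.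
      by rewrite inE andbC.
    rewrite big_mkcondr big_setU1 ?inE //= big_set1.
    by case: (v \in lab j); case: (w \in lab j).
  rewrite card2; have ne : (u \in lab j) || (v \in lab j) || (w \in lab j).
    have := Lne j jL; rewrite -setI_eq0 => /set0Pn[t]; rewrite Te !inE.
    by case/andP=> tl /orP[/orP[]|] /eqP E; rewrite -E tl ?orbT.
  apply/andP; split; first by case: ifP => _; rewrite ltW.
  rewrite /al /be.
  by case: (u \in lab j) ne; case: (v \in lab j); case: (w \in lab j) => //= _;
    case: (hc j) => [|[|k]]; rewrite /= ?addn0 ?addn1 ?addn2 ?expr0 ?expr1 ?mulr1 ?mul1r //.
have [xT' yT zT] : [/\ x \in T, y \in T & z \in T] by rewrite TE !inE !eqxx !orbT.
pose f v := \prod_(j in La) (if (hc j + #|lab j :&: (T :\ v)| == 1)%N then kappa else rho).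
have -> : \sum_(v in T) f v = f x + f y + f z.
  rewrite [in LHS]TE -setUA big_setU1 /= ?big_setU1 /= ?big_set1 ?addrA // !inE ?negb_or ?xy //.
have asym u v w : (a u v w = a u w v) * (b u v w = b u w v).
  by split; apply: eq_bigr => j _; rewrite /al /be;
    case: (u \in lab j); case: (v \in lab j); case: (w \in lab j).
have tri := triple_choice_cost q_gt0 qq (a8 x y z xT yT) (a8 y x z yT xT) (a8 z x y zT xT)
  (b4 x y z xT) (b4 y x z yT) (b4 z x y zT).
apply: le_trans tri.
have eyz : T = [set y; x; z] by rewrite TE (setUC [set x]).
have ezx : T = [set z; x; y] by rewrite TE setUC setUA.
have zy : z != y by rewrite eq_sym.
have yx : y != x by rewrite eq_sym.
have zx : z != x by rewrite eq_sym.
apply: lerD; first apply: lerD; first exact: key.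
  by apply: le_trans (key y x z eyz yx yz xz) _; rewrite !(asym z y x) [X in X * _ <= _]mulrC.
apply: le_trans (key z x y ezx zx zy xy) _; rewrite !(asym x z y) !(asym y z x).
by rewrite -[leLHS]mulrA mulrC.
Qed.
End Choice.

(** * Weighted counting of models and branching on a hitting set *)

Section Family.
Variables (V : finType) (h : nat) (S : {set {set V}}).
Implicit Types (A B X T a : {set V}).

Definition sat A B := [set a in S | (A \subset a) && [disjoint a & B]].

Definition triples :=
  [set T : {set V} | (#|T| == 3%N) && [forall a in S, ~~ [disjoint a & T]]].

Definition fresh A B X := ~: (A :|: B :|: X).

Definition link T := [set v | (v \notin T) && (v |: T \in triples)].

Lemma mem_satP A B a :
  reflect [/\ a \in S, A \subset a & [disjoint a & B]] (a \in sat A B).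
Proof. by rewrite inE; apply/(iffP and3P). Qed.

Lemma sat_sub A B A' B' : A \subset A' -> B \subset B' -> sat A' B' \subset sat A B.
Proof.
move=> AA BB; apply/subsetP=> a /mem_satP[aS Aa Ba]; apply/mem_satP; split=> //.
  exact: subset_trans Aa.
exact: disjointWr Ba.
Qed.

Variable R : realFieldType.

Definition weight X a : R := 2^-1 ^+ #|a :&: X|.

(* [A] are the ones, [B] the zeros and [X] the half variables. *)
Definition Z A B X : R := \sum_(a in sat A B) weight X a.

Lemma weight_ge0 X a : 0 <= weight X a.
Proof. by apply: exprn_ge0; rewrite invr_ge0. Qed.

Lemma weight_le1 X a : weight X a <= 1.
Proof. by apply: exprn_ile1; lra. Qed.

Lemma Z_ge0 A B X : 0 <= Z A B X.
Proof. by apply: sumr_ge0 => a _; apply: weight_ge0. Qed.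

Lemma Z_sub A B A' B' X : sat A B \subset sat A' B' -> Z A B X <= Z A' B' X.
Proof.
move=> /subsetP sub; rewrite /Z [leRHS](bigID [in sat A B]) /=.
rewrite (eq_bigl (fun a => (a \in sat A' B') && (a \in sat A B))).
  by rewrite lerDl sumr_ge0 // => a _; apply: weight_ge0.
by move=> a; case: (boolP (a \in sat A B)) => [/sub->|]; rewrite ?andbF.
Qed.

(** The general form of a branching, by exchanging sums: it is enough that the children containing a
    given model together carry its weight. *)
Lemma Z_cover (I : finType) (P : pred I) (w : I -> R) (A' B' X' : I -> {set V}) A B X :
  (forall i, P i -> 0 <= w i) ->
  (forall a, a \in sat A B ->
     weight X a <= \sum_(i | P i && (a \in sat (A' i) (B' i))) w i * weight (X' i) a) ->
  Z A B X <= \sum_(i | P i) w i * Z (A' i) (B' i) (X' i).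
Proof.
move=> w0 cov; apply: (le_trans (ler_sum _ cov)).
under eq_bigr do rewrite big_mkcondr.
rewrite exchange_big /=; apply: ler_sum => i Pi.
rewrite mulr_sumr -big_mkcondr /= [leRHS](bigID [in sat A B]) /=.
rewrite (eq_bigl (fun a => (a \in sat (A' i) (B' i)) && (a \in sat A B))) => [|a]; last exact: andbC.
by rewrite lerDl sumr_ge0 // => a _; rewrite mulr_ge0 ?w0 ?weight_ge0.
Qed.

(** If two fresh members of [F] are ones of a model, the children of both carry half its weight
    each. If exactly one is, its child carries all of it. Otherwise some half [u] in [F] is one:
    removing [u] from the half variables doubles the weight, which the coefficient 1/2 cancels. *)
Lemma Z_branch A B X (F : {set V}) :
  (forall a, a \in sat A B -> ~~ [disjoint a & F]) ->
  (forall a, a \in sat A B -> #|a :&: (F :\: X)| <= 2)%N ->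
  Z A B X <= \sum_(v in F) (if v \in X then 2^-1 else 1) * Z (v |: A) B ((X :|: F) :\ v).
Proof.
move=> hit le2; apply: Z_cover => [v _|a asat]; first by case: ifP => _; rewrite ?invr_ge0 ?ler01.
have [aS Aa Ba] := mem_satP _ _ _ asat.
have inb v : v \in F -> (a \in sat (v |: A) B) = (v \in a).
  move=> vF; apply/mem_satP/idP => [[_ /subsetP sub _]|va]; first by rewrite sub ?setU11.
  by split=> //; rewrite subUset sub1set va.
rewrite (eq_bigl [in a :&: F]) => [|v]; last first.
  by rewrite in_setI; case: (boolP (v \in F)) => vF; rewrite ?andbF // inb // andbT.
pose f := #|a :&: (F :\: X)|.
have cardU v : v \in a :&: F -> #|a :&: ((X :|: F) :\ v)|.+1 = (#|a :&: X| + f)%N.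
  rewrite inE => /andP[va vF].
  have -> : a :&: ((X :|: F) :\ v) = (a :&: (X :|: F)) :\ v.
    by apply/setP=> x; rewrite !inE; case: (x \in a); rewrite ?andbF.
  have <- : #|a :&: (X :|: F)| = (#|a :&: X| + f)%N.
    rewrite -(cardsID X (a :&: (X :|: F))); rewrite /f; congr (_ + _)%N;
    by apply: eq_card => x; rewrite !inE; case: (x \in a); case: (x \in X); rewrite ?andbF.
  by rewrite [RHS](cardsD1 v) !inE va vF orbT.
have w0 v : 0 <= (if v \in X then 2^-1 else 1) * weight ((X :|: F) :\ v) a.
  by rewrite mulr_ge0 ?weight_ge0 //; case: ifP => _; rewrite ?invr_ge0 ?ler01.
have sub0 (P : {set V}) : P \subset a :&: F ->
    \sum_(v in P) (if v \in X then 2^-1 else 1) * weight ((X :|: F) :\ v) a <=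
    \sum_(v in a :&: F) (if v \in X then 2^-1 else 1) * weight ((X :|: F) :\ v) a.
  move=> /subsetP PF; rewrite [leRHS](bigID [in P]) /=.
  rewrite (eq_bigl (fun v => (v \in a :&: F) && (v \in P))) ?lerDl ?sumr_ge0 // => v.
  by case: (boolP (v \in P)) => [/PF->|]; rewrite ?andbF.
have := le2 a asat; rewrite -/f leq_eqVlt ltnS leq_eqVlt ltnS leqn0 => /or3P[f2|f1|f0].
- have /cards2P[u [v [uv eF]]] := f2.
  have sF : [set u; v] \subset a :&: F by rewrite -eF setIS // subsetDl.
  apply: le_trans (sub0 _ sF); rewrite big_setU1 ?inE //= big_set1.
  have uX : (u \in X) = false by have /setP/(_ u) := eF; rewrite !inE eqxx; case: (u \in X); rewrite ?andbF.
  have vX : (v \in X) = false by have /setP/(_ v) := eF; rewrite !inE eqxx orbT; case: (v \in X); rewrite ?andbF.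
  have wE z : z \in a :&: F -> weight ((X :|: F) :\ z) a = weight X a / 2.
    move=> /cardU; rewrite (eqP f2) addn2 => -[e]; rewrite /weight e exprSr; lra.
  by rewrite uX vX !wE ?(subsetP sF) ?inE ?eqxx ?orbT //; lra.
- have /cards1P[u eF] := f1.
  have sF : [set u] \subset a :&: F by rewrite -eF setIS // subsetDl.
  apply: le_trans (sub0 _ sF); rewrite big_set1.
  have uX : (u \in X) = false by have /setP/(_ u) := eF; rewrite !inE eqxx; case: (u \in X); rewrite ?andbF.
  have := cardU u (subsetP sF u (set11 u)); rewrite (eqP f1) addn1 => -[e].
  by rewrite uX mul1r /weight e.
have [u] : exists u, u \in a :&: F.
  by apply/set0Pn; rewrite setI_eq0 hit.
move=> uaF; have sF : [set u] \subset a :&: F by rewrite sub1set.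
apply: le_trans (sub0 _ sF); rewrite big_set1.
have uX : u \in X.
  move: f0; rewrite /f cards_eq0 => /eqP/setP/(_ u); move: uaF; rewrite !inE => /andP[-> ->].
  by rewrite andbT; case: (u \in X).
have := cardU u uaF; rewrite (eqP f0) addn0 => e.
by rewrite uX /weight -e exprS.
Qed.
End Family.

Lemma disjP (T : finType) (A B : {set T}) :
  reflect (forall x, x \in A -> x \in B -> False) [disjoint A & B].
Proof.
rewrite disjoint_subset; apply: (iffP subsetP) => AB x xA; have := AB x xA; rewrite inE.
  by move/negP.
by move=> h; apply/negP.
Qed.

Lemma quarter_quarter (R : realFieldType) (w c t u : R) :
  4^-1 * (w * 4^-1 * c * (t * u)) = w * c * t * (16^-1 * u).
Proof. by field. Qed.

Lemma factor_half (R : realFieldType) (q w t : R) :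
  w / 2 * t + w / 2 * q * t = w * ((2^-1 + q / 2) * t).
Proof. by field. Qed.

Lemma sum_halves (R : realFieldType) (q w c t u z1 z2 z3 : R) :
  z1 <= w * (q / 2) * c * t -> z2 <= w * (q / 2) * c * t -> z3 <= w * c * t * u ->
  z1 + z2 + z3 <= w * c * t * (q + u).
Proof. lra. Qed.

(** * The invariant of the branching, and the gain from links *)

Section Core.
Variables (V : finType) (h : nat) (S : {set {set V}}).
Variables (R : realFieldType) (q : R).
Hypotheses (q_gt0 : 0 < q) (qq : q * q = 2 / 3).
Hypothesis cardV : #|V| = h.*2.
Hypothesis S_card : forall a, a \in S -> #|a| = h.
Hypothesis S_compl : forall a, a \in S -> ~: a \in S.
Local Notation sat := (sat S).
Local Notation triples := (triples S).
Local Notation Z := (Z S R).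
Hypothesis S_hit : forall A B : {set V}, (#|A| < h)%N -> exists F : {set V},
  [/\ (#|F| <= 3)%N, [disjoint F & A :|: B],
      forall a, a \in sat A B -> ~~ [disjoint a & F]
    & #|F| = 3%N -> F \in triples].
Implicit Types (A B X F P T a e : {set V}) (G L M : {set {set V}}).

Local Notation kappa := (kappa q).
Local Notation theta := (theta q).

(* [(2/q)^h] is [6^(n/4)]. *)
Definition budget A B X : R := (2 / q) ^+ h * 2^-1 ^+ #|A| * q ^+ (#|B| + #|X|).

(** The complement of [a] is a model too and meets [F]. *)
Lemma triple_not_full A B F a : F \in triples -> a \in sat A B -> ~~ (F \subset a).
Proof.
rewrite inE => /andP[_ /forallP hF] /mem_satP[aS _ _].
have := implyP (hF (~: a)) (S_compl aS).
by apply: contra => Fa; rewrite disjoint_sym disjoints_subset setCK.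
Qed.

Lemma budget_gt0 A B X : 0 < budget A B X.
Proof. by rewrite /budget !mulr_gt0 ?exprn_gt0 ?divr_gt0 ?invr_gt0. Qed.

Lemma bound_gt0 A B X m l : 0 < budget A B X * kappa ^+ m * theta ^+ l.
Proof.
rewrite mulr_gt0 ?exprn_gt0 ?theta_gt0 // mulr_gt0 ?budget_gt0 // exprn_gt0 //.
exact: lt_le_trans (kappa_ge1 q_gt0 qq).
Qed.

(* [G] contains every fresh pair forming a triple with a half variable, [L] is a
   set of links, and [mu] bounds the matching number of [G] on fresh variables. *)
Record good A B X G L (mu : nat) : Prop := Good {
  good_AB : [disjoint A & B];
  good_AX : [disjoint A & X];
  good_BX : [disjoint B & X];
  good_triple : forall F, F \in triples -> [disjoint F & A :|: B] ->
    (#|F :\: X| <= 2)%N /\ (#|F :\: X| = 2%N -> F :\: X \in G /\ F :\: X \notin L);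
  good_L : trivIset L;
  good_link : forall e, e \in L -> [/\ #|e| = 2%N, e \subset fresh A B X
    & forall a, a \in sat A B -> ~~ (e \subset a)];
  good_mu : forall M, M \subset G -> trivIset M -> cover M \subset fresh A B X ->
    (#|M| <= mu)%N }.

(** The set of fresh members of a triple can only shrink; if two remain, they are the same two as
    before, so their membership in [G] is inherited. *)
Lemma good_sub A B X G L mu A' B' X' L' mu' :
  good A B X G L mu -> A \subset A' -> B \subset B' ->
  [disjoint A' & B'] -> [disjoint A' & X'] -> [disjoint B' & X'] ->
  fresh A' B' X' \subset fresh A B X -> L' \subset L ->
  (forall e, e \in L' -> e \subset fresh A' B' X') ->
  (forall M, M \subset G -> trivIset M -> cover M \subset fresh A' B' X' ->
    (#|M| <= mu')%N) ->
  good A' B' X' G L' mu'.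
Proof.
move=> [AB AX BX gT gL gl _] AA BB AB' AX' BX' fr LL L'fr mu'P; split=> //.
- move=> F Ft FAB'.
  have FAB : [disjoint F & A :|: B] by apply: disjointWr FAB'; rewrite setUSS.
  have [le2 eq2] := gT F Ft FAB.
  have sub : F :\: X' \subset F :\: X.
    apply/subsetP => x; rewrite !inE => /andP[xX' xF]; rewrite xF andbT.
    have : x \in fresh A B X.
      apply: (subsetP fr); rewrite !inE (negPf xX') orbF.
      by apply/negP => xAB; case: (disjP _ _ FAB' x xF); rewrite inE.
    by rewrite !inE negb_or => /andP[].
  have le := subset_leq_card sub; split=> [|e2]; first exact: leq_trans le2.
  have -> : F :\: X' = F :\: X by apply/eqP; rewrite eqEcard sub e2.
  have [|-> nL] := eq2; first by apply/eqP; rewrite eqn_leq le2 -e2.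
  by split=> //; apply: contra nL; apply: (subsetP LL).
- exact: trivIsetS gL.
- move=> e eL'; have [e2 _ ne] := gl e (subsetP LL e eL'); split=> //; first exact: L'fr.
  by move=> a /(subsetP (sat_sub S AA BB)); apply: ne.
Qed.

(** [F] can be added to any matching that avoids it; the empty matching gives [0 < mu]. *)
Lemma good_mu_drop A B X G L mu F A' B' X' :
  good A B X G L mu -> F \in G -> F != set0 -> F \subset fresh A B X ->
  fresh A' B' X' \subset fresh A B X :\: F ->
  (0 < mu)%N /\
  (forall M, M \subset G -> trivIset M -> cover M \subset fresh A' B' X' ->
    (#|M| <= mu.-1)%N).
Proof.
move=> g FG F0 Ffr fr.
have key M : M \subset G -> trivIset M -> cover M \subset fresh A' B' X' -> (#|M| < mu)%N.
  move=> MG Mt Mc.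
  have cD : cover M \subset fresh A B X :\: F by apply: subset_trans fr.
  have dj e : e \in M -> [disjoint e & F].
    move=> eM; apply/disjP => x xe xF.
    have /(subsetP cD) : x \in cover M by apply/bigcupP; exists e.
    by rewrite inE xF.
  have FM : F \notin M.
    by apply/negP => /dj; rewrite -setI_eq0 setIid; apply/negP.
  have := good_mu g (M := F |: M); rewrite cardsU1 FM add1n; apply.
  - by rewrite subUset sub1set FG.
  - apply/trivIsetP => e1 e2 /setU1P[->|e1M] /setU1P[->|e2M] ne.
    + by rewrite eqxx in ne.
    + by rewrite disjoint_sym dj.
    + exact: dj.
    + exact: (trivIsetP Mt).
  - by rewrite /cover bigcup_setU big_set1 subUset Ffr (subset_trans cD) // subsetDl.
have e0 : trivIset (set0 : {set {set V}}) by apply/trivIsetP => e1 e2; rewrite inE.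
have c0 : cover (set0 : {set {set V}}) = set0 by rewrite /cover big_set0.
split; first by apply: leq_ltn_trans (key set0 _ _ _); rewrite ?c0 ?sub0set.
by move=> M h1 h2 h3; have := key M h1 h2 h3; case: (mu).
Qed.

Lemma card_links A B X G L mu : good A B X G L mu -> (#|L| * 2 <= #|fresh A B X|)%N.
Proof.
move=> g; have /eqP <- : \sum_(e in L) #|e| == (#|L| * 2)%N :> nat.
  by rewrite -sum_nat_const; apply/eqP/eq_bigr => e /(good_link g)[].
have /eqP <- : #|cover L| == (\sum_(e in L) #|e|)%N by rewrite (leq_card_cover L) (good_L g).
apply: subset_leq_card; apply/subsetP => x /bigcupP[e /(good_link g)[_ /subsetP s _]].
exact: s.
Qed.

Lemma card_parts A B X : [disjoint A & B] -> [disjoint A & X] -> [disjoint B & X] ->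
  (#|A| + #|B| + #|X| + #|fresh A B X| = h.*2)%N.
Proof.
move=> AB AX BX; rewrite -cardV -(cardsC (A :|: B :|: X)); congr (_ + _)%N.
rewrite cardsU cardsU disjoint_setI0 // cards0 subn0.
suff -> : (A :|: B) :&: X = set0 by rewrite cards0 subn0.
by rewrite setIUl !disjoint_setI0 // setU0.
Qed.

(** The only possible model is [A], so [Z] is at most 1, while the budget is [q] to the power minus
    the number of fresh variables. The links occupy [2 * #|L|] of these, and [q ^+ 2 <= theta]. *)
Lemma core_base A B X G L mu : good A B X G L mu -> (h <= #|A|)%N ->
  Z A B X <= budget A B X * kappa ^+ mu * theta ^+ #|L|.
Proof.
move=> g hA; have W0 := budget_gt0 A B X.
have c1 : 1 <= kappa ^+ mu by rewrite exprn_ege1 ?kappa_ge1.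
have t0 : 0 < theta ^+ #|L| by rewrite exprn_gt0 ?theta_gt0.
have sA a : a \in sat A B -> a = A /\ #|A| = h.
  move=> /mem_satP[/S_card ca Aa _]; have := subset_leq_card Aa; rewrite ca => Ah.
  have e : #|A| = h by apply/eqP; rewrite eqn_leq Ah.
  by split=> //; apply/eqP; rewrite eq_sym eqEcard Aa ca e /=.
have Z1 : Z A B X <= #|sat A B|%:R.
  rewrite -sum1_card natr_sum; apply: ler_sum => a _; exact: weight_le1.
have [e0|[a aS]] := set_0Vmem (sat A B).
  by apply: le_trans Z1 _; rewrite e0 cards0 ltW ?bound_gt0.
have [_ Ah] := sA a aS.
have {}Z1 : Z A B X <= 1.
  apply: le_trans Z1 _; rewrite lern1.
  have -> : 1%N = #|[set A]| by rewrite cards1.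
  by apply: subset_leq_card; apply/subsetP => b /sA[->]; rewrite inE.
apply: le_trans Z1 _.
have := card_parts (good_AB g) (good_AX g) (good_BX g).
rewrite Ah -addnn -!addnA => /addnI; rewrite addnA => cfr.
have fr0 : 0 < q ^+ #|fresh A B X| by rewrite exprn_gt0.
have -> : budget A B X = (q ^+ #|fresh A B X|)^-1.
  apply: (mulIf (lt0r_neq0 fr0)); rewrite mulVf ?lt0r_neq0 // /budget Ah.
  rewrite -[LHS]mulrA -exprD cfr -!exprMn.
  have -> : 2 / q * 2^-1 * q = 1 by field; rewrite lt0r_neq0.
  by rewrite expr1n.
have le1 : q ^+ #|fresh A B X| <= theta ^+ #|L|.
  apply: (@le_trans _ _ (q ^+ (2 * #|L|))).
    apply: ler_wiXn2l; [exact: ltW|exact: (q_le1 q_gt0 qq)|by rewrite mulnC (card_links g)].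
  by rewrite exprM lerXn2r ?nnegrE ?exprn_ge0 ?(ltW q_gt0) ?(ltW (theta_gt0 _)) ?qq_le_theta.
rewrite mulrAC; apply: (@le_trans _ _ ((q ^+ #|fresh A B X|)^-1 * theta ^+ #|L|)).
  by rewrite -(ler_pM2l fr0) mulr1 mulrA mulfV ?lt0r_neq0 // mul1r.
by rewrite ler_peMr // mulr_ge0 ?invr_ge0 ?ltW.
Qed.

(** A factor [q] is charged for every fresh member of [F] as for a half variable; it is refunded for
    [v], which becomes a one at cost 1/2. *)
Lemma budget_child A B X F P v :
  [disjoint A & X] -> [disjoint F & A :|: B] -> P \subset fresh A B X -> v \in F ->
  budget (v |: A) (B :|: P) ((X :|: F) :\ v) = budget A B X * (2^-1 * q ^+ (#|F :\: X| + #|P|) / q).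
Proof.
move=> AX FAB Pfr vF; rewrite /budget.
have vAB : v \notin A :|: B by apply/negP; apply: (disjP _ _ FAB).
have vA : v \notin A by apply: contra vAB => vA; rewrite inE vA.
have -> : #|v |: A| = #|A|.+1 by rewrite cardsU1 vA.
have -> : #|B :|: P| = (#|B| + #|P|)%N.
  rewrite cardsU disjoint_setI0 ?cards0 ?subn0 //; apply/disjP => x xB /(subsetP Pfr).
  by rewrite !inE xB orbT.
have e : #|(X :|: F) :\ v|.+1 = (#|X| + #|F :\: X|)%N.
  have <- : #|X :|: F| = (#|X| + #|F :\: X|)%N.
    by rewrite -(cardsID X (X :|: F)) setUK setDUl setDv set0U.
  by rewrite [RHS](cardsD1 v) !inE vF orbT.
have -> : q ^+ (#|B| + #|P| + #|(X :|: F) :\ v|) = q ^+ (#|B| + #|X|) * q ^+ (#|F :\: X| + #|P|) / q.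
  apply: (mulIf (lt0r_neq0 q_gt0)); rewrite divfK ?lt0r_neq0 // -exprD -exprSr.
  by congr (_ ^+ _); lia.
rewrite exprSr; move: (_ ^+ h) (_ ^+ #|A|) (q ^+ (_ + _)) (q ^+ (_ + _)) => w x y z.
by field; rewrite lt0r_neq0.
Qed.

Lemma good_child A B X G L mu F P v mu' :
  good A B X G L mu -> [disjoint F & A :|: B] -> v \in F ->
  P \subset fresh A B X -> [disjoint P & F] ->
  (forall e, e \in L -> [disjoint e & F] -> [disjoint e & P]) ->
  mu' = mu \/ mu' = mu.-1 /\ (F :\: X \in G /\ F :\: X != set0) ->
  good (v |: A) (B :|: P) ((X :|: F) :\ v) G [set e in L | [disjoint e & F]] mu'.
Proof.
move=> g FAB vF Pfr PF LP mu'E.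
have AB := disjP _ _ (good_AB g); have AX := disjP _ _ (good_AX g).
have BX := disjP _ _ (good_BX g); have FABp := disjP _ _ FAB; have PFp := disjP _ _ PF.
have Pp x : x \in P -> [/\ x \notin A, x \notin B & x \notin X].
  by move=> /(subsetP Pfr); rewrite !inE !negb_or -andbA => /and3P.
have frs : fresh (v |: A) (B :|: P) ((X :|: F) :\ v) \subset fresh A B X :\: (F :|: P).
  by apply/subsetP => x; rewrite !inE; case: (x =P v) => [->|_] //=;
    case: (x \in A); case: (x \in B); case: (x \in X); case: (x \in F); case: (x \in P).
have frs' : fresh (v |: A) (B :|: P) ((X :|: F) :\ v) \subset fresh A B X.
  exact: subset_trans frs (subsetDl _ _).
have sF : F :\: X \subset fresh A B X.
  apply/subsetP => x; rewrite !inE => /andP[xX xF]; rewrite (negPf xX) orbF.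
  by apply/negP => xAB; apply: (FABp x xF); rewrite inE.
apply: (good_sub g) => //.
- exact: subsetU1.
- exact: subsetUl.
- apply/disjP => x /setU1P[->|xA] /setUP[xB|xP].
  + by apply: (FABp v vF); rewrite inE xB orbT.
  + exact: PFp xP vF.
  + exact: AB xA xB.
  + by have [] := Pp x xP; rewrite xA.
- apply/disjP => x; rewrite !inE => /orP[/eqP->|xA]; first by rewrite eqxx.
  by case/andP=> _ /orP[/(AX x xA)//|xF]; apply: (FABp x xF); rewrite inE xA.
- apply/disjP => x; rewrite !inE => /orP[xB|xP] /andP[_ /orP[xX|xF]].
  + exact: BX xB xX.
  + by apply: (FABp x xF); rewrite inE xB orbT.
  + by have [_ _] := Pp x xP; rewrite xX.
  + exact: PFp xP xF.
- by apply/subsetP => e; rewrite inE => /andP[].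
- move=> e; rewrite inE => /andP[eL eF].
  have [_ efr _] := good_link g eL.
  apply/subsetP => x xe; have := subsetP efr x xe; rewrite !inE.
  rewrite !negb_or -andbA => /and3P[/negPf xA /negPf xB /negPf xX].
  have xF : x \notin F by apply/negP; apply: (disjP _ _ eF).
  have xP : x \notin P by apply/negP; apply: (disjP _ _ (LP e eL eF)).
  have -> : x != v by apply: contraNneq xF => ->.
  by rewrite xA xB xX (negPf xF) (negPf xP).
- case: mu'E => [->|[-> [FG F0]]].
    by move=> M MG Mt Mc; apply: (good_mu g) => //; apply: subset_trans frs'.
  have [|_] := good_mu_drop (A' := v |: A) (B' := B :|: P) (X' := (X :|: F) :\ v) g FG F0 sF.
    apply: subset_trans frs _; apply: setDS; apply: subset_trans (subsetUl _ _); exact: subsetDl.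
  exact.
Qed.

(* When the chosen variable [v] is linked, its partner [part v] becomes zero. *)
Section CoreStep.
Variables (A B X : {set V}) (G L : {set {set V}}) (mu : nat) (F : {set V}).
Hypotheses (g : good A B X G L mu) (F3 : (#|F| <= 3)%N) (FAB : [disjoint F & A :|: B]).
Hypothesis Ft : #|F| = 3%N -> F \in triples.

Let D := F :\: X.
Let L' := [set e in L | [disjoint e & F]].
Let part v := if [&& v \in D, v \in cover L & D \notin L] then pblock L v :\ v else set0.

(** A hitting set of size three is a triple, and [good_triple] leaves it at most two fresh
    members. *)
Let D2 : (#|D| <= 2)%N.
Proof.
have : (#|D| <= #|F|)%N by rewrite subset_leq_card // subsetDl.
move: F3; rewrite leq_eqVlt => /orP[/eqP/Ft FT _|]; first by have [] := good_triple g FT FAB.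
by rewrite ltnS => h1 h2; exact: leq_trans h1.
Qed.

Let Dfresh : D \subset fresh A B X.
Proof.
apply/subsetP => x; rewrite !inE => /andP[xX xF]; rewrite (negPf xX) orbF.
by apply/negP => xAB; apply: (disjP _ _ FAB x xF); rewrite inE.
Qed.

Let FfreshD x : x \in F -> x \in fresh A B X -> x \in D.
Proof. by rewrite !inE => -> ; rewrite !negb_or andbT => /andP[]. Qed.

Let link2 v : v \in cover L -> #|pblock L v| = 2%N.
Proof. by move=> /pblock_mem/(good_link g)[]. Qed.

(** If the partner of [v] were in [F], the two fresh members of [F] would form a link, a case
    excluded in [part]. *)
Let partP v : part v \subset fresh A B X /\ [disjoint part v & F].
Proof.
rewrite /part; case: ifP => [/and3P[vD vL DL]|_]; last first.
  by split; [exact: sub0set|rewrite -setI_eq0 set0I].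
have [e2 efr _] := good_link g (pblock_mem vL).
split; first by apply: subset_trans efr; apply: subsetDl.
apply/disjP => x; rewrite !inE => /andP[xv xe] xF.
have xD := FfreshD xF (subsetP efr x xe).
case/negP: DL; suff -> : D = pblock L v by exact: pblock_mem.
apply/eqP; rewrite eq_sym eqEcard e2 D2 andbT.
have /cards2P[y [z [yz ee]]] : #|pblock L v| == 2%N by rewrite e2.
have ve : v \in pblock L v by rewrite mem_pblock.
have e3 : [set v; x] = pblock L v.
  by apply/eqP; rewrite eqEcard subUset !sub1set ve xe e2 cards2 eq_sym xv.
by rewrite -e3 subUset !sub1set vD xD.
Qed.

Let part_card v : #|part v| = [&& v \in D, v \in cover L & D \notin L].
Proof.
rewrite /part; case: ifP => [/and3P[vD vL DL]|_]; last by rewrite cards0.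
by have := link2 vL; rewrite (cardsD1 v) mem_pblock vL add1n => -[].
Qed.

Let part_link v e : e \in L -> [disjoint e & F] -> [disjoint e & part v].
Proof.
move=> eL eF; rewrite /part; case: ifP => [/and3P[vD vL DL]|_]; last by rewrite -setI_eq0 setI0.
apply/disjP => x xe; rewrite inE => /andP[_ xp].
have e1 := def_pblock (good_L g) eL xe.
have e2 := def_pblock (good_L g) (pblock_mem vL) xp.
apply: (disjP _ _ eF v); last by move: vD; rewrite inE => /andP[].
by rewrite -e1 e2 mem_pblock.
Qed.

Let part_sat v a : v \in F -> a \in sat (v |: A) B -> a \in sat (v |: A) (B :|: part v).
Proof.
move=> vF /mem_satP[aS vAa aB]; apply/mem_satP; split=> //.
apply/disjP => x xa /setUP[xB|]; first exact: disjP aB x xa xB.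
rewrite /part; case: ifP => [/and3P[vD vL DL]|_]; last by rewrite inE.
rewrite !inE => /andP[xv xp].
have [e2 _ ne] := good_link g (pblock_mem vL).
have aAB : a \in sat A B.
  by apply/mem_satP; split=> //; apply: subset_trans vAa; apply: subsetUr.
case/negP: (ne a aAB).
have ve : v \in pblock L v by rewrite mem_pblock.
have -> : pblock L v = [set v; x].
  by apply/eqP; rewrite eq_sym eqEcard subUset !sub1set ve xp e2 cards2 eq_sym xv.
by rewrite subUset !sub1set xa (subsetP vAa) ?setU11.
Qed.

(** Every link that meets [F] contains a fresh member of [F], and links are disjoint; if [D] is a
    link, it is the only one lost. *)
Let removed_le : (#|L| <= #|L'| + (if D \in L then 1 else #|[set v in D | v \in cover L]|))%N.
Proof.
have -> : #|L| = (#|L'| + #|L :\: L'|)%N.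
  rewrite -(cardsID L' L); congr (_ + _)%N; apply: eq_card => e.
  by rewrite !inE; case: (e \in L).
rewrite leq_add2l; have rem e : e \in L :\: L' -> exists x, [/\ x \in D, x \in cover L & e = pblock L x].
  rewrite !inE => /andP[+ eL]; rewrite eL /= -setI_eq0 => /set0Pn[x].
  rewrite inE => /andP[xe xF]; exists x; have [_ efr _] := good_link g eL; split.
  - exact: FfreshD xF (subsetP efr x xe).
  - by apply/bigcupP; exists e.
  - by rewrite (def_pblock (good_L g) eL xe).
case: ifP => DL.
  rewrite -(cards1 D) subset_leq_card //; apply/subsetP => e /rem[x [xD _ ->]].
  by rewrite inE (def_pblock (good_L g) DL xD).
apply: leq_trans (leq_imset_card (pblock L) _); apply: subset_leq_card.
by apply/subsetP => e /rem[x [xD xL ->]]; apply: imset_f; rewrite inE xD.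
Qed.

Hypothesis hit : forall a, a \in sat A B -> ~~ [disjoint a & F].
Hypothesis IH : forall A' B' X' L1 mu', #|A'| = #|A|.+1 -> good A' B' X' G L1 mu' ->
  Z A' B' X' <= budget A' B' X' * kappa ^+ mu' * theta ^+ #|L1|.

Lemma core_step : Z A B X <= budget A B X * kappa ^+ mu * theta ^+ #|L|.
Proof.
have c0 : 0 < kappa by apply: lt_le_trans (kappa_ge1 q_gt0 qq).
have t0 := theta_gt0 q_gt0; have t1 := theta_le1 q_gt0 qq.
have le2 a : a \in sat A B -> (#|a :&: (F :\: X)| <= 2)%N.
  by move=> _; apply: leq_trans (subset_leq_card (subsetIr _ _)) D2.
apply: le_trans (Z_branch R hit le2) _.
(* The unfavourable case of one half and two fresh members: [D] is then a pair of [G], so the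
   matching bound drops by one and releases the factor [kappa]. *)
pose b3 := (#|D| == 2%N) && (#|F| == 3%N).
pose mu' := if b3 then mu.-1 else mu.
have [muE DnL] : kappa ^+ mu' * kappa ^+ b3 = kappa ^+ mu /\ (b3 -> D \notin L /\ D \in G /\ (0 < mu)%N).
  rewrite /mu'; case: (boolP b3) => [/andP[/eqP d2 /eqP f3]|_]; last by rewrite mulr1.
  have [_ /(_ d2)[DG DL]] := good_triple g (Ft f3) FAB.
  have D0 : D != set0 by rewrite -card_gt0 d2.
  have [|mu0 _] := good_mu_drop (A' := setT) (B' := B) (X' := X) g DG D0 Dfresh.
    by rewrite /fresh !setTU setCT sub0set.
  by rewrite -exprD addn1 prednK.
pose K0 := budget A B X * kappa ^+ mu' * theta ^+ #|L'|.
have K00 : 0 <= K0 by exact: ltW (bound_gt0 _ _ _ _ _).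
have child v : v \in F -> Z (v |: A) B ((X :|: F) :\ v) <= K0 * (2^-1 * q ^+ (#|D| + #|part v|) / q).
  move=> vF; have [pfr pF] := partP v.
  apply: (@le_trans _ _ (Z (v |: A) (B :|: part v) ((X :|: F) :\ v))).
    by apply: Z_sub; apply/subsetP => a; apply: part_sat.
  have vA : v \notin A by apply/negP => vA; apply: (disjP _ _ FAB v vF); rewrite inE vA.
  have gd : good (v |: A) (B :|: part v) ((X :|: F) :\ v) G L' mu'.
    apply: good_child g FAB vF pfr pF (part_link v) _; rewrite /mu'.
    case: (boolP b3) => [b3T|_]; [right|by left].
    have [_ [DG _]] := DnL b3T; split=> //; split=> //.
    by rewrite -card_gt0; case/andP: b3T => /eqP->.
  apply: le_trans (IH _ gd) _; first by rewrite cardsU1 vA.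
  by rewrite (budget_child (good_AX g) FAB pfr vF) -/D [X in X * _ <= _]mulrAC [leLHS]mulrAC.
have -> : budget A B X * kappa ^+ mu * theta ^+ #|L| =
    budget A B X * kappa ^+ mu' * (kappa ^+ b3 * theta ^+ #|L|) by rewrite -muE !mulrA.
(* An upper bound for the number of links lost, each of which withdraws a factor [theta] from the
   bounds of the children. *)
pose r := if D \in L then 1%N else #|[set v in D | v \in cover L]|.
have thL : theta ^+ #|L'| * theta ^+ r <= theta ^+ #|L|.
  by rewrite -exprD ler_wiXn2l // ltW.
pose coef := \sum_(v in F) (if v \in X then 2^-1 else 1) * (2^-1 * q ^+ (#|D| + #|part v|) / q).
apply: (@le_trans _ _ (K0 * coef)).
  rewrite mulr_sumr; apply: ler_sum => v vF; rewrite mulrCA ler_wpM2l ?child //.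
  by case: ifP => _; rewrite ?invr_ge0.
suff hcoef : coef <= kappa ^+ b3 * theta ^+ r.
  apply: (@le_trans _ _ (K0 * (kappa ^+ b3 * theta ^+ r))); first by rewrite ler_wpM2l.
  rewrite /K0 -mulrA ler_wpM2l //.
    by have := bound_gt0 A B X mu' 0; rewrite expr0 mulr1 => /ltW.
  by rewrite mulrCA ler_wpM2l // exprn_ge0 // ltW.
pose k := #|F :&: X|.
have kD : (k + #|D| <= 3)%N by rewrite /k /D cardsID.
have coefE : coef = (2^-1 * (2^-1 * q ^+ #|D| / q)) *+ k +
    \sum_(v in D) 2^-1 * q ^+ (#|D| + [&& v \in D, v \in cover L & D \notin L]) / q.
  rewrite /coef (bigID [in X]) /=; congr (_ + _).
    rewrite (eq_bigl [in F :&: X]) => [|v]; last by rewrite inE.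
    rewrite (eq_bigr (fun=> 2^-1 * (2^-1 * q ^+ #|D| / q))) ?sumr_const // => v.
    by rewrite inE => /andP[_ vX]; rewrite vX part_card !inE vX /= addn0.
  rewrite (eq_bigl [in D]) => [|v]; last by rewrite inE andbC.
  apply: eq_bigr => v vD; rewrite part_card; move: (vD); rewrite inE => /andP[/negPf-> _].
  by rewrite mul1r.
rewrite coefE.
have [d0|d0] := posnP #|D|.
  have /eqP D0 := d0; rewrite cards_eq0 in D0; rewrite (eqP D0) in kD *.
  have b30 : b3 = false by rewrite /b3 d0.
  rewrite b30 mul1r cards0 big_set0 addr0.
  have -> : r = 0%N.
    rewrite /r; case: ifP => [DL|_]; first by have [] := good_link g DL; rewrite d0.
    by apply/eqP; rewrite cards_eq0 (eqP D0); apply/eqP/setP => x; rewrite !inE.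
  by rewrite expr0 no_fresh_cost //; rewrite cards0 addn0 in kD.
have [d1|d1] := eqVneq #|D| 1%N.
  have /cards1P[x Dx] : #|D| == 1%N by rewrite d1.
  have DL : D \notin L by apply/negP => /(good_link g)[]; rewrite d1.
  have b30 : b3 = false by rewrite /b3 d1.
  rewrite b30 mul1r d1 Dx big_set1 -Dx DL andbT Dx inE eqxx /=.
  have -> : r = (x \in cover L).
    rewrite /r (negPf DL) Dx; case: (boolP (x \in cover L)) => xL.
      by rewrite (_ : [set _ | _] = [set x]) ?cards1 //; apply/setP => y; rewrite !inE; case: eqP => // ->.
    by apply/eqP; rewrite cards_eq0; apply/eqP/setP => y; rewrite !inE; case: eqP => // ->; rewrite (negPf xL).
  by rewrite add1n one_fresh_cost //; move: kD; rewrite d1 addn1.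
have d2 : #|D| = 2%N by apply/eqP; move: D2 d0 d1; case: (#|D|) => [|[|[|]]].
(* With two fresh members, the hitting set has size three exactly when it has one half member. *)
have b3k : (b3 : nat) = k.
  have : #|F| = (k + #|D|)%N by rewrite /k /D cardsID.
  rewrite d2.
  rewrite /b3 d2 eqxx /= => ->; have : (k <= 1)%N by move: kD; rewrite d2 addn2.
  by case: (k) => [|[|]].
have /cards2P[x [y [xy Dxy]]] : #|D| == 2%N by rewrite d2.
rewrite d2 b3k Dxy big_setU1 ?inE //= big_set1 -Dxy.
have [xD yD] : x \in D /\ y \in D by rewrite Dxy !inE !eqxx orbT.
have k1 : (k <= 1)%N by move: kD; rewrite d2 addn2.
(* If [D] is a link, [F] has no half member: a triple would have its two fresh members outside [L]
   by [good_triple]. *)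
rewrite eqxx yD /=; case: (boolP (D \in L)) => DL.
  rewrite !andbF /= !addn0.
  have k0 : k = 0%N.
    by rewrite -b3k; case: (boolP b3) => // /DnL[]; rewrite DL.
  by rewrite k0 mulr0n add0r expr0 mul1r /r DL expr1 linked_pair_cost.
rewrite !andbT.
have -> : r = ((x \in cover L) + (y \in cover L))%N.
  rewrite /r (negPf DL) -sum1_card big_mkcond /=.
  rewrite (eq_bigr (fun v => if v \in D then (v \in cover L : nat) else 0%N)); last first.
    by move=> v _; rewrite inE; case: (v \in D) => //=; case: (v \in cover L).
  by rewrite -big_mkcond /= Dxy big_setU1 ?inE //= big_set1.
by rewrite !add2n two_fresh_cost.
Qed.
End CoreStep.

Lemma core_bound A B X G L mu : good A B X G L mu ->
  Z A B X <= budget A B X * kappa ^+ mu * theta ^+ #|L|.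
Proof.
have [n] := ubnP (h - #|A|); elim: n A B X L mu => // n IHn A B X L mu hn g.
have [hA|hA] := leqP h #|A|; first exact: core_base g hA.
have [F [F3 FAB hit Ft]] := S_hit B hA.
apply: (core_step g F3 FAB Ft hit) => A' B' X' L1 mu' cA g'; apply: IHn g'; lia.
Qed.

(** * Direct branching on pairs with two half labels *)

(** A model with both [x] and [y] shares its weight between the first two children. If it has
    neither, the two triples force [v] and [v'] to be ones, and these two half variables account for
    the factor 1/4. *)
Lemma Z_double A B X x y v v' :
  x != y -> [set x; y] \subset fresh A B X -> v != v' -> v \in X -> v' \in X ->
  v \in link S [set x; y] -> v' \in link S [set x; y] ->
  Z A B X <= Z (x |: A) B (y |: X) + Z (y |: A) B (x |: X) +
    4^-1 * Z (v |: (v' |: A)) (B :|: [set x; y]) (X :\ v :\ v').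
Proof.
move=> xy efr vv' vX v'X; rewrite !inE => /andP[_ /andP[_ /forallP vT]] /andP[_ /andP[_ /forallP v'T]].
have := subsetP efr x; have := subsetP efr y; rewrite !inE !eqxx !orbT !negb_or -!andbA.
move=> /(_ isT)/and3P[yA yB yX] /(_ isT)/and3P[xA xB xX].
pose As := nth A [:: x |: A; y |: A; v |: (v' |: A)].
pose Bs := nth B [:: B; B; B :|: [set x; y]].
pose Xs := nth X [:: y |: X; x |: X; X :\ v :\ v'].
pose ws := nth (0 : R) [:: 1; 1; 4^-1].
have := @Z_cover V S R 'I_3 predT (fun i => ws i) (fun i => As i) (fun i => Bs i) (fun i => Xs i) A B X.
rewrite !big_ord_recl big_ord0 /= /bump /= !mul1r addr0 addrA; apply.
  by case=> [] [|[|[|]]] //= *; rewrite invr_ge0.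
move=> a asat; rewrite big_mkcond !big_ord_recl big_ord0 /= /bump /= !mul1r addr0.
have [aS Aa aB] := mem_satP _ _ _ _ asat.
have w0 Y : 0 <= weight R Y a by apply: weight_ge0.
have inS z : z \in a -> a \in sat (z |: A) B.
  by move=> za; apply/mem_satP; split=> //; rewrite subUset sub1set za.
have wU z : z \notin X -> weight R (z |: X) a = if z \in a then weight R X a / 2 else weight R X a.
  move=> zX; rewrite /weight; case: ifP => za.
    have -> : #|a :&: (z |: X)| = #|a :&: X|.+1.
      rewrite (cardsD1 z) !inE za eqxx /= add1n; congr _.+1; apply: eq_card => u.
      by rewrite !inE; case: eqP => //= ->; rewrite (negPf zX) andbF.
    by rewrite exprSr.
  congr (_ ^+ _); apply: eq_card => u; rewrite !inE; case: eqP => // ->.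
  by rewrite za.
case: (boolP (x \in a)) => xa; case: (boolP (y \in a)) => ya.
- rewrite !inS // !wU // xa ya addrA; apply: (@le_trans _ _ (weight R X a / 2 + weight R X a / 2)).
    by rewrite -splitr.
  by rewrite lerDl; case: ifP => _ //; rewrite mulr_ge0 // invr_ge0.
- rewrite inS // wU // (negPf ya) lerDl addr_ge0 //; first by case: ifP.
  by case: ifP => _ //; rewrite mulr_ge0 // invr_ge0.
- rewrite (inS y) // (wU x) // (negPf xa) addrCA lerDl addr_ge0 //; first by case: ifP.
  by case: ifP => _ //; rewrite mulr_ge0 // invr_ge0.
have inT z : ~~ [disjoint a & z |: [set x; y]] -> z \in a.
  rewrite -setI_eq0 => /set0Pn[u]; rewrite !inE => /andP[ua /or3P[]/eqP E].
  - by rewrite -E.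
  - by rewrite E (negPf xa) in ua.
  - by rewrite E (negPf ya) in ua.
have va := inT v (implyP (vT a) aS); have v'a := inT v' (implyP (v'T a) aS).
have -> : a \in sat (v |: (v' |: A)) (B :|: [set x; y]).
  apply/mem_satP; split=> //; first by rewrite !subUset !sub1set va v'a.
  apply/disjP => u ua /setUP[uB|]; first exact: disjP aB u ua uB.
  by rewrite !inE => /orP[]/eqP E; rewrite E ?(negPf xa) ?(negPf ya) in ua.
have -> : weight R X a = 4^-1 * weight R (X :\ v :\ v') a.
  rewrite /weight; have -> : #|a :&: X| = #|a :&: (X :\ v :\ v')|.+2.
    rewrite (cardsD1 v) !inE va vX /= add1n (cardsD1 v') !inE v'a v'X eq_sym vv' /= add1n.
    by congr _.+2; apply: eq_card => u; rewrite !inE; case: (u \in a); rewrite ?andbF.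
  by rewrite !exprS; lra.
rewrite addrA lerDr addr_ge0 //; by case: ifP.
Qed.

(** Induction on [P]. Branching on a pair of [P] removes it from the fresh variables, so one [kappa]
    is released, and the total cost of the children is at most [rho = kappa * theta]. *)
Lemma double_bound A B X G L mu (P : {set {set V}}) :
  good A B X G L mu -> P \subset G -> trivIset P ->
  (forall e, e \in P -> [/\ #|e| = 2%N, e \subset fresh A B X, [disjoint e & cover L]
    & (1 < #|link S e :&: X|)%N]) ->
  (forall v, v \in X -> (#|[set e in P | v \in link S e]| <= 4)%N) ->
  Z A B X <= budget A B X * kappa ^+ mu * theta ^+ (#|L| + #|P|).
Proof.
have [n] := ubnP #|P|; elim: n A B X mu P => // n IHn A B X mu P hn g PG Pt PP P4.
have [->|[e eP]] := set_0Vmem P; first by rewrite cards0 addn0; exact: core_bound g.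
have [e2 efr eL lab2] := PP e eP.
have AB := disjP _ _ (good_AB g); have AX := disjP _ _ (good_AX g); have BX := disjP _ _ (good_BX g).
have frE x : x \in e -> [/\ x \notin A, x \notin B & x \notin X].
  by move=> /(subsetP efr); rewrite !inE !negb_or -andbA => /and3P.
have Le x f : x \in e -> f \in L -> x \in f -> False.
  by move=> xe fL xf; apply: (disjP _ _ eL x xe); apply/bigcupP; exists f.
have Pe x f : x \in e -> f \in P :\ e -> x \in f -> False.
  move=> xe; rewrite !inE => /andP[fe fP] xf; have := trivIsetP Pt f e fP eP fe.
  by move=> /disjP/(_ x xf xe).
have cardP : #|P| = #|P :\ e|.+1 by rewrite (cardsD1 e) eP.
have e0 : e != set0 by rewrite -card_gt0 e2.
have eG := subsetP PG e eP.
(* The induction hypothesis in the form shared by the three children, which all take [e] out of the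
   fresh variables. *)
have stepA (A' B' X' : {set V}) (P' : {set {set V}}) :
    A \subset A' -> B \subset B' -> [disjoint A' & B'] -> [disjoint A' & X'] -> [disjoint B' & X'] ->
    fresh A' B' X' = fresh A B X :\: e -> P' \subset P :\ e ->
    (forall f, f \in P' -> (1 < #|link S f :&: X'|)%N) ->
    (forall v, v \in X' -> v \in X \/ v \in e) ->
    Z A' B' X' <= budget A' B' X' * kappa ^+ mu.-1 * theta ^+ (#|L| + #|P'|).
  move=> AA BB AB' AX' BX' fr PP' lab' X'X.
  have [|mu0 mudrop] := good_mu_drop (A' := A') (B' := B') (X' := X') g eG e0 efr; first by rewrite fr.
  have subfr (f : {set V}) : f \subset fresh A B X -> (forall x, x \in e -> x \in f -> False) ->
      f \subset fresh A' B' X'.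
    move=> ffr fe; rewrite fr; apply/subsetP => x xf; rewrite inE (subsetP ffr) // andbT.
    by apply/negP => xe; apply: (fe x).
  have P'P : P' \subset P by apply: subset_trans PP' (subsetDl _ _).
  have g' : good A' B' X' G L mu.-1.
    apply: (good_sub g) => //; first by rewrite fr subsetDl.
    by move=> f fL; have [_ ffr _] := good_link g fL; apply: subfr => // x xe; apply: Le.
  apply: IHn => //.
  - by apply: leq_ltn_trans (subset_leq_card PP') _; rewrite -ltnS -cardP.
  - exact: subset_trans PG.
  - exact: trivIsetS Pt.
  - move=> f fP'; have [f2 ffr fL _] := PP f (subsetP P'P f fP'); split=> //; last exact: lab'.
    by apply: subfr => // x xe; apply: Pe xe (subsetP PP' f fP').
  - move=> v /X'X[vX|ve].
      apply: leq_trans (P4 v vX); apply: subset_leq_card; apply/subsetP => f.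
      by rewrite !inE => /andP[/(subsetP P'P)-> ->].
    (* A new half variable in [e] labels no pair of [P']: together they would be a triple of three
       fresh variables, which [good_triple] forbids. *)
    rewrite (_ : [set _ in _ | _] = set0) ?cards0 //; apply/setP => f; rewrite in_set0 inE.
    apply/negP => /andP[fP' vf]; have [f2 ffr _ _] := PP f (subsetP P'P f fP').
    have [vA vB vX] := frE v ve; have := vf; rewrite inE => /andP[vnf vfT].
    have [|le2 _] := good_triple g vfT.
      apply/disjP => x /setU1P[->|/(subsetP ffr)]; rewrite !inE; first by rewrite (negPf vA) (negPf vB).
      by move=> + E; rewrite E.
    have E : (v |: f) :\: X = v |: f.
      apply/setP => x; rewrite !inE; case: eqP => [->|_] /=; first by rewrite vX.
      by case: (boolP (x \in f)) => [/(subsetP ffr)|]; rewrite ?andbF // !inE !negb_or => /andP[_ ->].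
    by move: le2; rewrite E cardsU1 vnf f2.
have /cards2P[x [y [xy exy]]] : #|e| == 2%N by rewrite e2.
have [xe ye] : x \in e /\ y \in e by rewrite exy !inE !eqxx orbT.
have [xA xB xX] := frE x xe; have [yA yB yX] := frE y ye.
have /card_gt1P[v [v' [vl v'l vv']]] := lab2.
move: vl v'l; rewrite !in_setI => /andP[vl vX] /andP[v'l v'X].
have := Z_double xy; rewrite -exy => /(_ A B X v v' efr vv' vX v'X vl v'l) Zle.
have half (s t : V) : s \in e -> t \in e -> s != t -> e = [set s; t] ->
    Z (s |: A) B (t |: X) <= budget A B X * (q / 2) * kappa ^+ mu.-1 * theta ^+ (#|L| + #|P :\ e|).
  move=> se te st est; have [sA sB sX] := frE s se; have [tA tB tX] := frE t te.
  have -> : budget A B X * (q / 2) = budget (s |: A) B (t |: X).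
    by rewrite /budget !cardsU1 sA tX !add1n addnS !exprS; move: (_ ^+ h) => w; lra.
  apply: stepA => //.
  - exact: subsetU1.
  - by apply/disjP => z /setU1P[->|zA] zB; [rewrite zB in sB|apply: AB zA zB].
  - apply/disjP => z /setU1P[->|zA] /setU1P[E|zX].
    + by rewrite E eqxx in st.
    + by rewrite zX in sX.
    + by rewrite -E zA in tA.
    + exact: AX zA zX.
  - by apply/disjP => z zB /setU1P[E|zX]; [rewrite -E zB in tB|apply: BX zB zX].
  - by apply/setP => z; rewrite est !inE; case: (z == s); case: (z == t); rewrite ?orbT.
  - move=> f; rewrite inE => /andP[_ fP]; have [_ _ _ l2] := PP f fP.
    by apply: leq_trans l2 (subset_leq_card _); rewrite setIS // subsetUr.
  - by move=> z /setU1P[->|]; [right|left].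
(* In the third child [v] and [v'] are no longer half. Besides [e], each of them labels at most
   three pairs, so at most six pairs are dropped. *)
pose P2 := [set f in P :\ e | (v \notin link S f) && (v' \notin link S f)].
have P2card : (#|P :\ e| <= #|P2| + 6)%N.
  have lab3 u : u \in X -> u \in link S e -> (#|[set f in P :\ e | u \in link S f]| <= 3)%N.
    move=> uX ul; have := P4 u uX; rewrite (cardsD1 e) inE eP ul add1n ltnS; congr (_ <= _)%N.
    by apply: eq_card => f; rewrite !inE andbA.
  have := lab3 v vX vl; have := lab3 v' v'X v'l.
  have sub : P :\ e \subset P2 :|: ([set f in P :\ e | v \in link S f] :|: [set f in P :\ e | v' \in link S f]).
    apply/subsetP => f fPe; rewrite /P2 !in_setU ![f \in [set _ in _ | _]]in_set fPe /=.
    by case: (v \in link S f); case: (v' \in link S f).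
  move=> c1 c2; apply: leq_trans (subset_leq_card sub) _.
  apply: leq_trans (leq_card_setU _ _) _; rewrite leq_add2l.
  by apply: leq_trans (leq_card_setU _ _) _; apply: (@leq_add _ _ 3 3).
(* Two new ones cost 1/4; the two new zeros are offset by the two half variables that disappear. *)
have third : Z (v |: (v' |: A)) (B :|: e) (X :\ v :\ v') <=
    budget A B X * 4^-1 * kappa ^+ mu.-1 * theta ^+ (#|L| + #|P2|).
  have -> : budget A B X * 4^-1 = budget (v |: (v' |: A)) (B :|: e) (X :\ v :\ v').
    have v'A : v' \notin A by apply/negP => v'A; apply: AX v'A v'X.
    have vA : v \notin A by apply/negP => vA; apply: AX vA vX.
    have Be : #|B :|: e| = (#|B| + 2)%N.
      rewrite cardsU e2 disjoint_setI0 ?cards0 ?subn0 //.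
      by apply/disjP => z zB /frE[_ zB' _]; rewrite zB in zB'.
    have Xe : #|X| = #|X :\ v :\ v'|.+2.
      by rewrite (cardsD1 v) vX add1n (cardsD1 v') !inE eq_sym vv' v'X add1n.
    rewrite /budget Be !cardsU1 !inE negb_or vv' vA v'A !add1n Xe !addnS addn0 !addSn !exprS.
    by move: (_ ^+ h) => w; lra.
  apply: stepA.
  - by rewrite setUA subsetUr.
  - exact: subsetUl.
  - apply/disjP => z; rewrite !inE => /or3P[/eqP->|/eqP->|zA] /orP[zB|ze].
    + exact: BX zB vX.
    + by have [_ _] := frE v ze; rewrite vX.
    + exact: BX zB v'X.
    + by have [_ _] := frE v' ze; rewrite v'X.
    + exact: AB zA zB.
    + by have [] := frE z ze; rewrite zA.
  - apply/disjP => z; rewrite !inE => /or3P[/eqP->|/eqP->|zA]; rewrite ?eqxx ?andbF //.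
    by move=> /and3P[_ _]; apply: AX.
  - apply/disjP => z; rewrite !inE => /orP[zB|ze] /and3P[_ _ zX]; first exact: BX zB zX.
    by have [_ _] := frE z ze; rewrite zX.
  - apply/setP => z; rewrite !inE; case: (z =P v) => [->|_] /=; first by rewrite vX !orbT andbF.
    case: (z =P v') => [->|_] /=; first by rewrite v'X !orbT andbF.
    by case: (z \in A); case: (z \in B); case: (z \in X); case: (z \in e).
  - by apply/subsetP => f; rewrite inE => /andP[].
  - move=> f; rewrite inE => /andP[fPe /andP[vf v'f]].
    have [_ _ _ l2] := PP f (subsetP (subsetDl _ _) f fPe).
    apply: leq_trans l2 (subset_leq_card _); apply/subsetP => z /setIP[zf zX].
    rewrite in_setI zf !in_setD1 zX andbT /=; apply/andP; split.
      by apply: contraNneq v'f => <-.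
    by apply: contraNneq vf => <-.
  - by move=> z; rewrite !inE => /and3P[_ _]; left.
have mu0 : (0 < mu)%N.
  have [|//] := good_mu_drop (A' := setT) (B' := B) (X' := X) g eG e0 efr.
  by rewrite /fresh !setTU setCT sub0set.
have t0 := theta_gt0 q_gt0; have t1 := theta_le1 q_gt0 qq.
have := half x y xe ye xy exy.
have := half y x ye xe; rewrite eq_sym xy setUC => /(_ isT exy).
have W0 := budget_gt0 A B X; have c0 : 0 < kappa ^+ mu.-1.
  by rewrite exprn_gt0 // (lt_le_trans ltr01) ?kappa_ge1.
have tl : 0 < theta ^+ (#|L| + #|P :\ e|) by rewrite exprn_gt0.
have t6 : 0 < theta ^+ 6 by rewrite exprn_gt0.
have hP2 : theta ^+ (#|L| + #|P2|) <= theta ^+ (#|L| + #|P :\ e|) * (theta ^+ 6)^-1.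
  rewrite -(ler_pM2r t6) mulfVK ?lt0r_neq0 // -exprD.
  by apply: ler_wiXn2l; [exact: ltW|exact: t1|rewrite -addnA leq_add2l].
have := double_pair_cost q_gt0 qq; rewrite invfM -(kappa_theta qq) => dc h2 h1.
apply: (le_trans Zle).
have -> : budget A B X * kappa ^+ mu * theta ^+ (#|L| + #|P|) =
    (budget A B X * kappa ^+ mu.-1 * theta ^+ (#|L| + #|P :\ e|)) * (kappa * theta).
  rewrite cardP addnS -[in LHS](prednK mu0) !exprS.
  by move: kappa theta (budget A B X) (kappa ^+ _) (theta ^+ _) => c' t' w c t; ring.
have h3 : 4^-1 * Z (v |: (v' |: A)) (B :|: e) (X :\ v :\ v') <=
    (budget A B X * kappa ^+ mu.-1 * theta ^+ (#|L| + #|P :\ e|)) * (16^-1 / theta ^+ 6).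
  apply: (@le_trans _ _ (4^-1 * (budget A B X * 4^-1 * kappa ^+ mu.-1 * (theta ^+ (#|L| + #|P :\ e|) * (theta ^+ 6)^-1)))).
    rewrite ler_wpM2l ?invr_ge0 //; apply: le_trans third _.
    apply: ler_wpM2l hP2; apply: mulr_ge0; last exact: ltW.
    by apply: mulr_ge0; rewrite ?invr_ge0 // ltW.
  by rewrite quarter_quarter.
have K0 : 0 < budget A B X * kappa ^+ mu.-1 * theta ^+ (#|L| + #|P :\ e|).
  by apply: mulr_gt0 => //; apply: mulr_gt0.
apply: (@le_trans _ _ ((budget A B X * kappa ^+ mu.-1 * theta ^+ (#|L| + #|P :\ e|)) * (q + 16^-1 / theta ^+ 6))); last first.
  by rewrite ler_pM2l.
exact: sum_halves h1 h2 h3.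
Qed.

Lemma card_set_sum (J : finType) (D : {set J}) (p : pred J) :
  #|[set j in D | p j]| = (\sum_(j in D) p j)%N.
Proof.
rewrite -sum1_card big_mkcond [RHS]big_mkcond /=; apply: eq_bigr => j _.
by rewrite inE; case: (j \in D) => //=; case: (p j).
Qed.

Lemma card_setIU (X Y l : {set V}) : [disjoint X & Y] ->
  #|l :&: (X :|: Y)| = (#|l :&: X| + #|l :&: Y|)%N.
Proof.
move=> XY; rewrite setIUr cardsU; suff -> : l :&: X :&: (l :&: Y) = set0 by rewrite cards0 subn0.
apply/setP => x; rewrite !inE; apply/negP => /andP[/andP[_ xX] /andP[_ xY]].
exact: disjP XY x xX xY.
Qed.

Lemma mem_link T v : T \in triples -> v \in T -> v \in link S (T :\ v).
Proof. by move=> Tt vT; rewrite /link in_set in_setD1 eqxx /= setD1K. Qed.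

(** * Branching on a maximal family of disjoint triples *)

Section Matching.
Variables (A0 B0 : {set V}) (TT : {set {set V}}) (M : {set {set V}}).
Hypothesis AB0 : [disjoint A0 & B0].
Hypothesis TTtriple : forall T, T \in TT -> T \in triples.
Hypothesis TTfree : forall T, T \in TT -> [disjoint T & A0 :|: B0].
Hypothesis TTdisj : trivIset TT.
Hypothesis TTmax : forall F, F \in triples -> [disjoint F & A0 :|: B0] ->
  ~~ [disjoint F & cover TT].
Hypothesis small_links : forall v (P : {set {set V}}), v \notin A0 :|: B0 -> trivIset P ->
  (forall e, e \in P -> [/\ #|e| = 2%N, [disjoint e & A0 :|: B0] & v \in link S e]) ->
  (#|P| <= 5)%N.

(* The pairs that may form a triple with a half variable after branching on [TT]. *)
Definition half_pairs := [set e : {set V} | [&& #|e| == 2%N, [disjoint e & A0 :|: B0 :|: cover TT]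
  & ~~ [disjoint link S e & cover TT]]].

Hypothesis Mhalf : M \subset half_pairs.
Hypothesis Mdisj : trivIset M.
Hypothesis Mmax : forall M', M' \subset half_pairs -> trivIset M' -> (#|M'| <= #|M|)%N.

Let cov := cover TT.
Let lab e := link S e :&: cov.
Let pair_factor X e : R := if #|lab e :&: X| == 1%N then kappa else rho R.
(** [ts] holds the triples still to be branched on; a pair receives its factor once all its labels
    in [cov] are decided. *)
Let factor (ts : {set {set V}}) X e : R := if [disjoint lab e & cover ts] then pair_factor X e else 1.

Let cov_free x : x \in cov -> x \in A0 :|: B0 -> False.
Proof. by case/bigcupP => T TTT xT; apply: (disjP _ _ (TTfree TTT)). Qed.

(** The triple of [TT] through [v] supplies one more pair in the link of [v], disjoint from those in
    [M]; [small_links] allows five in all. *)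
Let label_le4 v : v \in cov -> (#|[set e in M | v \in link S e]| <= 4)%N.
Proof.
move=> vc; set P := [set e in M | _]; have TTT := pblock_mem vc.
have vT : v \in pblock TT v by rewrite mem_pblock.
set T := pblock TT v in TTT vT.
have /andP[/eqP T3 _] : (#|T| == 3%N) && [forall a in S, ~~ [disjoint a & T]].
  by have := TTtriple TTT; rewrite inE.
have T2 : #|T :\ v| = 2%N by move: T3; rewrite (cardsD1 v) vT add1n => -[].
have eT e x : e \in P -> x \in e -> x \in T -> False.
  rewrite inE => /andP[/(subsetP Mhalf)]; rewrite inE => /and3P[_ /disjP d _] _ xe xT.
  by apply: (d x xe); rewrite !inE; apply/orP; right; apply/bigcupP; exists T.
have nP : T :\ v \notin P.
  apply/negP => /eT; have /card_gt0P[x xT] : (0 < #|T :\ v|)%N by rewrite T2.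
  by move=> /(_ x xT); apply; move: xT; rewrite inE => /andP[].
have := @small_links v ((T :\ v) |: P); rewrite cardsU1 nP add1n ltnS; apply.
- by apply/negP; apply: cov_free.
- apply/trivIsetP => e f /setU1P[->|eP] /setU1P[->|fP] ne.
  + by rewrite eqxx in ne.
  + by apply/disjP => x xT xf; apply: eT fP xf _; move: xT; rewrite inE => /andP[].
  + by apply/disjP => x xf xT; apply: eT eP xf _; move: xT; rewrite inE => /andP[].
  + by apply: (trivIsetP Mdisj) ne; [move: eP|move: fP]; rewrite inE => /andP[].
move=> e /setU1P[->|eP].
  split=> //; first by apply: disjointWl (TTfree TTT); apply: subsetDl.
  by apply: mem_link => //; apply: TTtriple.
move: eP; rewrite inE => /andP[/(subsetP Mhalf) + vl]; rewrite inE => /and3P[/eqP e2 d _].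
by split=> //; apply: disjointWr d; apply: subsetUl.
Qed.

(** All of [cov] is now one or half. A matched pair without half labels is a link, one with at least
    two is handled by [double_bound], and one with a single half label pays the full [kappa]. *)
Let triple_phase_end A X : A0 \subset A -> [disjoint A & X] -> A :|: X = A0 :|: cov ->
  Z A B0 X <= budget A B0 X * \prod_(e in M) pair_factor X e.
Proof.
move=> AA /disjP AX AXE.
have inAX x : (x \in A) || (x \in X) = (x \in A0) || (x \in cov).
  by have /setP/(_ x) := AXE; rewrite !inE.
have Xcov x : x \in X -> x \in cov.
  move=> xX; have := inAX x; rewrite xX orbT => /esym/orP[xA0|//].
  by case: (AX x (subsetP AA x xA0) xX).
have GP e : e \in half_pairs -> [/\ #|e| = 2%N, e \subset fresh A B0 X & exists v, v \in lab e].
  rewrite inE => /and3P[/eqP e2 d l]; split=> //.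
    apply/subsetP => x xe; rewrite !inE orbAC inAX; apply/negP => h1.
    apply: (disjP _ _ d x xe); rewrite !inE; move: h1.
    by case: (x \in A0); case: (x \in B0); case: (x \in cov).
  by move: l; rewrite -setI_eq0 => /set0Pn[v vl]; exists v.
pose L := [set e in M | #|lab e :&: X| == 0%N].
pose P := [set e in M | (1 < #|lab e :&: X|)%N].
have LM : L \subset M by apply/subsetP => e; rewrite inE => /andP[].
have PM : P \subset M by apply/subsetP => e; rewrite inE => /andP[].
have g : good A B0 X half_pairs L #|M|.
  split.
  - apply/disjP => x xA xB; have := inAX x; rewrite xA => /esym/orP[xA0|xc].
      exact: disjP AB0 x xA0 xB.
    by apply: (cov_free xc); rewrite inE xB orbT.
  - by apply/disjP.
  - apply/disjP => x xB xX; apply: (cov_free (Xcov x xX)); by rewrite inE xB orbT.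
  (* By maximality of [TT] the triple meets [cov], in a variable that is not one and hence half; at
     most two members are fresh. *)
  - move=> F Ft FAB.
    have FA0 : [disjoint F & A0 :|: B0] by apply: disjointWr FAB; rewrite setSU.
    have := TTmax Ft FA0; rewrite -setI_eq0 => /set0Pn[v]; rewrite inE => /andP[vF vc].
    have vX : v \in X.
      have := inAX v; rewrite vc orbT => /orP[vA|//].
      by case: (disjP _ _ FAB v vF); rewrite inE vA.
    have /andP[/eqP F3 _] : (#|F| == 3%N) && [forall a in S, ~~ [disjoint a & F]] by rewrite inE in Ft.
    have F2 : #|F :\ v| = 2%N by move: F3; rewrite (cardsD1 v) vF add1n => -[].
    have sub : F :\: X \subset F :\ v by apply: setDS; rewrite sub1set.
    split=> [|c2]; first by rewrite -F2 subset_leq_card.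
    have E : F :\: X = F :\ v by apply/eqP; rewrite eqEcard sub F2 c2.
    have vl : v \in lab (F :\ v) by rewrite in_setI mem_link.
    rewrite E; split.
      rewrite inE F2 eqxx /=; apply/andP; split; last first.
        by rewrite -setI_eq0; apply/set0Pn; exists v.
      apply/disjP => x xF; rewrite -E !inE in xF *; case/andP: xF => xX xF.
      have nA : x \notin A by apply/negP => xA; apply: (disjP _ _ FAB x xF); rewrite inE xA.
      have nB : x \notin B0 by apply/negP => xB; apply: (disjP _ _ FAB x xF); rewrite inE xB orbT.
      have := inAX x; rewrite (negPf nA) (negPf xX) /= => /esym.
      by rewrite orbAC => ->; rewrite (negPf nB).
    by rewrite inE negb_and -lt0n; apply/orP; right; apply/card_gt0P; exists v; rewrite inE vl.
  - exact: trivIsetS Mdisj.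
  (* Any label of [e] is a one and forms a triple with [e]; since no model contains a triple, [e] is
     indeed a link. *)
  - move=> e eL; have := subsetP LM e eL => eM.
    have [e2 efr [v]] := GP e (subsetP Mhalf e eM); rewrite inE => /andP[vl vc].
    split=> // a asat.
    have vX : v \notin X.
      apply/negP => vX; move: eL; rewrite inE => /andP[_]; rewrite cards_eq0 => /eqP/setP/(_ v).
      by rewrite in_set0 !in_setI vl vc vX.
    have vA : v \in A by have := inAX v; rewrite vc orbT (negPf vX) orbF.
    have := vl; rewrite inE => /andP[_ /triple_not_full/(_ asat)].
    apply: contra => ea; rewrite subUset ea sub1set andbT.
    by have [_ /subsetP->] := mem_satP _ _ _ _ asat.
  - by move=> M' M'G M't _; apply: Mmax.
have := double_bound g (subset_trans PM Mhalf) (trivIsetS PM Mdisj).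
move=> /(_ _ _)/le_trans; apply.
- move=> e eP; have [e2 efr _] := GP e (subsetP Mhalf e (subsetP PM e eP)).
  split=> //; last first.
    move: eP; rewrite inE => /andP[_]; move=> h1; apply: leq_trans h1 (subset_leq_card _).
    by rewrite setSI // subsetIl.
  apply/disjP => x xe /bigcupP[f fL xf].
  have ef : e != f.
    apply: contraTneq fL => <-; move: eP; rewrite !inE => /andP[_]; rewrite negb_and -lt0n.
    by move=> /ltnW ->; rewrite orbT.
  exact: disjP (trivIsetP Mdisj e f (subsetP PM e eP) (subsetP LM f fL) ef) x xe xf.
- move=> v vX; apply: leq_trans (label_le4 (Xcov v vX)); apply: subset_leq_card.
  by apply/subsetP => e; rewrite !inE => /andP[/andP[-> _] ->].
rewrite -mulrA ler_pM2l ?budget_gt0 // le_eqVlt; apply/orP; left; apply/eqP.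
have -> : (#|L| + #|P|)%N = (\sum_(e in M) (#|lab e :&: X| != 1%N))%N.
  by rewrite !card_set_sum -big_split /=; apply: eq_bigr => e _; case: (#|_|) => [|[|]].
have -> : kappa ^+ #|M| = \prod_(e in M) kappa by rewrite prodr_const.
rewrite -prodrXr -big_split /=; apply: eq_bigr => e _.
by rewrite /pair_factor; case: (_ == _); rewrite ?expr0 ?expr1 ?mulr1 // kappa_theta.
Qed.

(** Induction on the triples left. Each choice in a triple costs 1/3 of the budget, so the factors
    need only have average at most 1 over the three choices; this is [choice_sum]. *)
Let triple_phase (ts : {set {set V}}) A X : ts \subset TT -> A0 \subset A -> [disjoint A & X] ->
  A :|: X :|: cover ts = A0 :|: cov -> [disjoint A :|: X & cover ts] ->
  Z A B0 X <= budget A B0 X * \prod_(e in M) factor ts X e.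
Proof.
have [n] := ubnP #|ts|; elim: n ts A X => // n IHn ts A X hn tsTT AA AX AXE dts.
have [ts0|[T Tts]] := set_0Vmem ts.
  have c0 : cover ts = set0 by rewrite ts0 /cover big_set0.
  rewrite (eq_bigr (pair_factor X)) => [|e _]; last by rewrite /factor c0 -setI_eq0 setI0 eqxx.
  by apply: triple_phase_end => //; rewrite -AXE c0 setU0.
have TTT := subsetP tsTT T Tts.
have covT : cover ts = T :|: cover (ts :\ T).
  by rewrite /cover (bigD1 T Tts) /=; congr (_ :|: _); apply: eq_bigl => e; rewrite !inE andbC.
have dT : [disjoint T & cover (ts :\ T)].
  rewrite coverD1 ?(trivIsetS tsTT) //; apply/disjP => x xT; rewrite inE => /andP[+ _].
  by rewrite xT.
have TAX x : x \in T -> x \in A :|: X -> False.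
  by move=> xT xAX; apply: (disjP _ _ dts x xAX); rewrite covT inE xT.
have TX : [disjoint T & X] by apply/disjP => x xT xX; apply: (TAX x xT); rewrite inE xX orbT.
have TDX : T :\: X = T by apply/setDidPl.
have TAB : [disjoint T & A :|: B0].
  apply/disjP => x xT; rewrite inE => /orP[xA|xB]; first by apply: (TAX x xT); rewrite inE xA.
  by apply: (disjP _ _ (TTfree TTT) x xT); rewrite inE xB orbT.
have Tt := TTtriple TTT.
have /andP[/eqP T3 /forallP Thit] : (#|T| == 3%N) && [forall a in S, ~~ [disjoint a & T]].
  by rewrite inE in Tt.
have hit a : a \in sat A B0 -> ~~ [disjoint a & T] by case/mem_satP => aS _ _; apply: (implyP (Thit a)).
have le2 a : a \in sat A B0 -> (#|a :&: (T :\: X)| <= 2)%N.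
  move=> asat; rewrite TDX -ltnS -T3; apply: proper_card; rewrite properEneq subsetIr andbT.
  by apply: contra (triple_not_full Tt asat) => /eqP/setIidPr.
apply: le_trans (Z_branch R hit le2) _.
have XT v : v \in T -> (X :|: T) :\ v = X :|: (T :\ v).
  move=> vT; apply/setP => x; rewrite !inE; case: (x =P v) => [->|_] //=.
  by rewrite orbF; apply/esym/negP => vX; apply: (disjP _ _ TX v vT).
have child v : v \in T -> (if v \in X then 2^-1 else 1) * Z (v |: A) B0 ((X :|: T) :\ v) <=
    budget A B0 X / 3 * \prod_(e in M) factor (ts :\ T) (X :|: (T :\ v)) e.
  move=> vT; rewrite XT //.
  have -> : (v \in X) = false by apply/negP; apply: (disjP _ _ TX v vT).
  rewrite mul1r.
  have <- : budget (v |: A) B0 (X :|: (T :\ v)) = budget A B0 X / 3.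
    have := budget_child AX TAB (sub0set (fresh A B0 X)) vT; rewrite XT // setU0 => ->.
    by rewrite TDX T3 cards0 addn0 half_cube.
  apply: IHn.
  - by move: hn; rewrite (cardsD1 T) Tts add1n ltnS.
  - by apply: subset_trans tsTT; apply: subsetDl.
  - by apply: subset_trans AA _; apply: subsetUr.
  - apply/disjP => x; rewrite !inE => /orP[/eqP->|xA].
      by rewrite eqxx => /orP[vX|//]; apply: (disjP _ _ TX v vT).
    case/orP => [xX|/andP[_ xT]]; first exact: disjP AX x xA xX.
    by apply: (TAX x xT); rewrite inE xA.
  - rewrite -AXE covT; apply/setP => x; rewrite !inE; case: (x =P v) => [->|_] /=.
      by rewrite vT !orbT.
    by case: (x \in A); case: (x \in X); case: (x \in T).
  - apply/disjP => x; rewrite !inE => xAX xc.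
    have xc' : x \in cover ts by rewrite covT inE xc orbT.
    case/orP: xAX => [/orP[/eqP xv|xA]|/orP[xX|/andP[_ xT]]].
    + by apply: (disjP _ _ dT x _ xc); rewrite xv.
    + by apply: (disjP _ _ dts x _ xc'); rewrite inE xA.
    + by apply: (disjP _ _ dts x _ xc'); rewrite inE xX orbT.
    + exact: disjP dT x xT xc.
apply: le_trans (ler_sum _ child) _; rewrite -mulr_sumr -mulrA ler_pM2l ?budget_gt0 //.
(* The pairs whose last undecided labels lie in [T]; the factors of all other pairs do not depend on
   the choice in [T]. *)
pose La := [set e in M | [disjoint lab e & cover (ts :\ T)] && ~~ [disjoint lab e & T]].
pose rest := \prod_(e in M :\: La) factor ts X e.
have pair_factor_gt0 Y e : 0 < pair_factor Y e.
  by rewrite /pair_factor; case: ifP => _; rewrite ?rho_gt0 // (lt_le_trans ltr01) ?kappa_ge1.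
have factor_gt0 us Y e : 0 < factor us Y e by rewrite /factor; case: ifP.
have LaM : La \subset M by apply/subsetP => e; rewrite inE => /andP[].
have split us Y : \prod_(e in M) factor us Y e = \prod_(e in M :\: La) factor us Y e * \prod_(e in La) factor us Y e.
  rewrite (bigID [in La]) /= mulrC; congr (_ * _); apply: eq_bigl => e; rewrite ?in_setD 1?andbC //.
  by case: (boolP (e \in La)) => [/(subsetP LaM)->|].
have dlab e : [disjoint lab e & cover ts] = [disjoint lab e & T] && [disjoint lab e & cover (ts :\ T)].
  by rewrite covT -!setI_eq0 setIUr setU_eq0.
have La1 : \prod_(e in La) factor ts X e = 1.
  apply: big1 => e; rewrite inE => /and3P[_ _ /negPf nd]; by rewrite /factor dlab nd.
have hrest v : v \in T -> \prod_(e in M :\: La) factor (ts :\ T) (X :|: (T :\ v)) e = rest.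
  move=> vT; apply: eq_bigr => e; rewrite !inE => /andP[+ eM]; rewrite eM /= /factor dlab.
  case: (boolP [disjoint lab e & cover (ts :\ T)]) => /= d1; last by rewrite andbF.
  rewrite negbK => d2; rewrite d2 /= /pair_factor; suff -> : lab e :&: (X :|: (T :\ v)) = lab e :&: X by [].
  apply/setP => x; rewrite [LHS]in_setI [RHS]in_setI in_setU in_setD1.
  case: (boolP (x \in lab e)) => //= xl.
  case: (boolP (x \in T)) => xT; last by rewrite andbF orbF.
  by case: (disjP _ _ d2 x xl xT).
have hLa u : u \in T -> \prod_(e in La) factor (ts :\ T) (X :|: (T :\ u)) e =
    \prod_(e in La) (if (#|lab e :&: X| + #|lab e :&: (T :\ u)| == 1)%N then kappa else rho R).
  move=> uT; apply: eq_bigr => e; rewrite inE => /and3P[_ d _]; rewrite /factor d /pair_factor card_setIU //.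
  by rewrite disjoint_sym; apply: disjointWl TX; apply: subsetDl.
rewrite (eq_bigr (fun v => rest * \prod_(e in La) (if (#|lab e :&: X| + #|lab e :&: (T :\ v)| == 1)%N then kappa else rho R))); last first.
  by move=> v vT; rewrite split hrest // hLa.
rewrite -mulr_sumr split La1 mulr1 -/rest.
have rest0 : 0 < rest by apply: prodr_gt0.
rewrite mulrCA -[leRHS]mulr1 ler_pM2l //.
have := @choice_sum V R q q_gt0 qq _ La lab (fun e => #|lab e :&: X|) T T3.
move=> /(_ _ _) h3; rewrite mulrC ler_pdivrMr ?mul1r //; apply: h3.
  by move=> e; rewrite inE => /and3P[].
move=> v vT; have vc : v \in cov by apply/bigcupP; exists T.
apply: leq_trans (label_le4 vc); apply: subset_leq_card; apply/subsetP => e.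
rewrite in_set => /andP[eLa]; rewrite in_setI => /andP[vl _].
by rewrite in_set (subsetP LaM e eLa) vl.
Qed.

(** At the start every pair of [M] has an undecided label, so all factors are 1. *)
Lemma matching_bound : Z A0 B0 set0 <= budget A0 B0 set0.
Proof.
have := @triple_phase TT A0 set0 (subxx _) (subxx _); rewrite setU0 => /(_ _ _ _)/le_trans; apply.
- by rewrite -setI_eq0 setI0.
- by [].
- apply/disjP => x xA /cov_free; apply; by rewrite inE xA.
rewrite big1 ?mulr1 // => e /(subsetP Mhalf); rewrite inE => /and3P[_ _].
rewrite /factor -!setI_eq0 => /set0Pn[v vl]; case: eqP => // /setP/(_ v).
by rewrite in_set0 in_setI vl /=; move: vl; rewrite in_setI => /andP[_ ->].
Qed.
End Matching.

(** * Eliminating variables with many disjoint pairs in their link *)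

Lemma exists_largest (p : pred {set {set V}}) : p set0 ->
  exists2 M, p M & forall M', p M' -> (#|M'| <= #|M|)%N.
Proof. by move=> p0; case: (arg_maxnP (fun M => #|M|) p0) => M pM Mmax; exists M. Qed.

Lemma trivIset0 : trivIset (set0 : {set {set V}}).
Proof. by apply/trivIsetP => e f; rewrite inE. Qed.

Lemma Z_set0 A B : Z A B set0 = #|sat A B|%:R.
Proof.
rewrite -sum1_card natr_sum; apply: eq_bigr => a _.
by rewrite /weight setI0 cards0 expr0.
Qed.

Lemma Z_split A B A1 B1 A2 B2 :
  (forall a, a \in sat A B -> a \in sat A1 B1 \/ a \in sat A2 B2) ->
  Z A B set0 <= Z A1 B1 set0 + Z A2 B2 set0.
Proof.
move=> cov; rewrite !Z_set0 -natrD ler_nat.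
apply: leq_trans (leq_card_setU (sat A1 B1) (sat A2 B2)); apply: subset_leq_card.
by apply/subsetP => a /cov; rewrite in_setU => -[]->; rewrite ?orbT.
Qed.

Lemma budget_one A B v : v \notin A -> budget (v |: A) B set0 = budget A B set0 / 2.
Proof. by move=> vA; rewrite /budget cardsU1 vA exprS; lra. Qed.

Lemma budget_zero A B v : v \notin B -> budget A (v |: B) set0 = budget A B set0 * q.
Proof. by move=> vB; rewrite /budget cardsU1 vB addSn exprSr mulrA. Qed.

(* With [v] zero, each pair of its link contains a one: decide [x] to be one, or
   [x] to be zero and [y] to be one. *)
Lemma clean_pairs (N : nat) v A B (P : {set {set V}}) :
  (forall A' B', [disjoint A' & B'] -> (#|~: (A' :|: B')| < N)%N ->
     Z A' B' set0 <= budget A' B' set0) ->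
  [disjoint A & B] -> (#|~: (A :|: B)| < N)%N -> v \in B -> trivIset P ->
  (forall e, e \in P -> [/\ #|e| = 2%N, [disjoint e & A :|: B] & v \in link S e]) ->
  Z A B set0 <= budget A B set0 * (2^-1 + q / 2) ^+ #|P|.
Proof.
move=> IH; have [n] := ubnP #|P|; elim: n A B P => // n IHn A B P hn AB hN vB Pt PP.
have [->|[e eP]] := set_0Vmem P; first by rewrite cards0 expr0 mulr1 IH.
have [e2 eAB vl] := PP e eP.
have /cards2P[x [y [xy exy]]] : #|e| == 2%N by rewrite e2.
have frE z : z \in e -> z \notin A /\ z \notin B.
  by move=> ze; split; apply/negP => zAB; apply: (disjP _ _ eAB z ze); rewrite inE zAB ?orbT.
have [xe ye] : x \in e /\ y \in e by rewrite exy !inE !eqxx orbT.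
have [[xA xB] [yA yB]] := (frE x xe, frE y ye).
have cP : #|P| = #|P :\ e|.+1 by rewrite (cardsD1 e) eP.
have step A' B' : A \subset A' -> B \subset B' -> A' :|: B' \subset A :|: B :|: e ->
    [disjoint A' & B'] -> Z A' B' set0 <= budget A' B' set0 * (2^-1 + q / 2) ^+ #|P :\ e|.
  move=> AA BB sub AB'; apply: IHn => //.
  - by rewrite -ltnS -cP.
  - by apply: leq_ltn_trans hN; rewrite subset_leq_card // setCS setUSS.
  - exact: (subsetP BB).
  - by apply: trivIsetS Pt; apply: subsetDl.
  move=> f; rewrite in_setD1 => /andP[fe fP]; have [f2 fAB vf] := PP f fP; split=> //.
  apply/disjP => z zf /(subsetP sub); rewrite in_setU => /orP[]; first exact: disjP fAB z zf.
  exact: disjP (trivIsetP Pt f e fP eP fe) z zf.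
have h1 : Z (x |: A) B set0 <= budget A B set0 / 2 * (2^-1 + q / 2) ^+ #|P :\ e|.
  rewrite -(budget_one B xA); apply: step => //; first exact: subsetUr.
    apply/subsetP => z; rewrite !inE => /orP[/orP[/eqP->|->]|->] //; first by rewrite xe orbT.
    by rewrite orbT.
  by apply/disjP => z /setU1P[->|zA]; [apply/negP|apply: (disjP _ _ AB)].
have h2 : Z (y |: A) (x |: B) set0 <= budget A B set0 / 2 * q * (2^-1 + q / 2) ^+ #|P :\ e|.
  rewrite -(budget_one B yA) -(budget_zero _ xB); apply: step; try exact: subsetUr.
    apply/subsetP => z; rewrite !inE => /orP[/orP[/eqP->|->]|/orP[/eqP->|->]]; rewrite ?xe ?ye ?orbT //.
  apply/disjP => z /setU1P[->|zA] /setU1P[E|zB].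
  - by rewrite E eqxx in xy.
  - by rewrite zB in yB.
  - by rewrite -E zA in xA.
  - exact: disjP AB z zA zB.
apply: le_trans (Z_split (A1 := x |: A) (B1 := B) (A2 := y |: A) (B2 := x |: B) _) _.
  move=> a /mem_satP[aS Aa aB]; case: (boolP (x \in a)) => xa; [left|right].
    by apply/mem_satP; split=> //; rewrite subUset sub1set xa.
  have ya : y \in a.
    move: vl; rewrite inE => /andP[_]; rewrite inE => /andP[_ /forallP/(_ a)]; rewrite aS /=.
    rewrite -setI_eq0 => /set0Pn[z]; rewrite exy !inE => /andP[za /or3P[]/eqP E].
    - by rewrite E in za; case: (disjP _ _ aB v za vB).
    - by rewrite E (negPf xa) in za.
    - by rewrite -E.
  apply/mem_satP; split=> //; first by rewrite subUset sub1set ya.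
  by apply/disjP => z za /setU1P[E|zB]; [rewrite E (negPf xa) in za|apply: disjP aB z za zB].
apply: le_trans (lerD h1 h2) _; by rewrite cP exprS factor_half.
Qed.

(** Induction on the number of undecided variables. A variable with six disjoint pairs in its link
    is decided, using [clean_pairs] and [star_cost]; if there is none, [matching_bound] applies to
    largest [TT] and [M]. *)
Lemma clean_bound A B : [disjoint A & B] -> Z A B set0 <= budget A B set0.
Proof.
have [N] := ubnP #|~: (A :|: B)|; elim: N A B => // N IHN A B hN AB.
pose big v (P : {set {set V}}) := [&& v \notin A :|: B, trivIset P, (6 <= #|P|)%N &
  [forall e in P, [&& #|e| == 2%N, [disjoint e & A :|: B] & v \in link S e]]].
case: (boolP [exists v, [exists P, big v P]]) => [/existsP[v /existsP[P /and4P[vAB Pt P6 /forallP PP]]]|nbig].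
  have [vA vB] : v \notin A /\ v \notin B by move: vAB; rewrite inE negb_or => /andP[].
  have vfree : v \in ~: (A :|: B) by rewrite inE.
  have less A' B' : A' :|: B' = v |: (A :|: B) -> (#|~: (A' :|: B')| < N)%N.
    move=> ->; rewrite -ltnS; apply: leq_ltn_trans hN; apply: proper_card.
    rewrite properE setCS subsetUr /=; apply/negP => /subsetP/(_ v vfree).
    by rewrite !inE eqxx.
  apply: le_trans (Z_split (A1 := v |: A) (B1 := B) (A2 := A) (B2 := v |: B) _) _.
    move=> a /mem_satP[aS Aa aB]; case: (boolP (v \in a)) => va; [left|right].
      by apply/mem_satP; split=> //; rewrite subUset sub1set va.
    apply/mem_satP; split=> //.
    by apply/disjP => z za /setU1P[E|zB]; [rewrite E (negPf va) in za|apply: disjP aB z za zB].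
  have h1 : Z (v |: A) B set0 <= budget A B set0 / 2.
    rewrite -(budget_one B vA); apply: IHN; first by apply: less; rewrite setUA.
    by apply/disjP => z /setU1P[->|zA]; [apply/negP|apply: (disjP _ _ AB)].
  have ABv : [disjoint A & v |: B].
    by apply/disjP => z zA /setU1P[E|zB]; [rewrite -E zA in vA|apply: disjP AB z zA zB].
  have h2 := @clean_pairs N v A (v |: B) P.
  have {}h2 : Z A (v |: B) set0 <= budget A B set0 * q * (2^-1 + q / 2) ^+ #|P|.
    rewrite -(budget_zero A vB); apply: h2 => //.
    - by move=> A' B' AB' lt; apply: IHN.
    - by apply: less; rewrite setUCA.
    - exact: setU11.
    - move=> e eP; have := PP e; rewrite eP => /and3P[/eqP e2 d vl]; split=> //.
      apply/disjP => z ze; rewrite setUCA => /setU1P[E|]; last exact: disjP d z ze.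
      by move: vl; rewrite inE -E ze.
  apply: le_trans (lerD h1 h2) _.
  have r6 : (2^-1 + q / 2) ^+ #|P| <= (2^-1 + q / 2) ^+ 6 :> R by exact: (star_pow q_gt0 qq P6).
  have := star_cost q_gt0 qq; have W0 := budget_gt0 A B set0 => cl.
  have : q * (2^-1 + q / 2) ^+ #|P| <= 2^-1 by apply: le_trans cl; rewrite ler_pM2l.
  move=> h3; rewrite -[leRHS]mulr1 -mulrA -mulrDr ler_pM2l //.
  by rewrite [leRHS]splitr mul1r lerD2l.
have small v (P : {set {set V}}) : v \notin A :|: B -> trivIset P ->
    (forall e, e \in P -> [/\ #|e| = 2%N, [disjoint e & A :|: B] & v \in link S e]) ->
    (#|P| <= 5)%N.
  move=> vAB Pt PP; rewrite leqNgt; apply: contra nbig => P6.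
  apply/existsP; exists v; apply/existsP; exists P; rewrite /big vAB Pt P6 /=.
  by apply/forallP => e; apply/implyP => /PP[-> -> ->].
pose okT (P : {set {set V}}) :=
  trivIset P && [forall T in P, (T \in triples) && [disjoint T & A :|: B]].
have [TT /andP[TTt /forallP TTok] TTmax] : exists2 TT, okT TT & forall P : {set {set V}}, okT P -> (#|P| <= #|TT|)%N.
  by apply: exists_largest; rewrite /okT trivIset0; apply/forallP => T; rewrite inE.
pose okM (P : {set {set V}}) := (P \subset half_pairs A B TT) && trivIset P.
have [M /andP[MG Mt] Mmax] : exists2 M, okM M & forall P : {set {set V}}, okM P -> (#|P| <= #|M|)%N.
  by apply: exists_largest; rewrite /okM trivIset0 sub0set.
have TTok' T : T \in TT -> T \in triples /\ [disjoint T & A :|: B].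
  by move=> TTT; have := TTok T; rewrite TTT => /andP[].
apply: (@matching_bound A B TT M) => //.
- by move=> T /TTok'[].
- by move=> T /TTok'[].
- move=> F Ft FAB; apply/negP => dF.
  have F3 : #|F| = 3%N by move: Ft; rewrite inE => /andP[/eqP].
  have dFT T : T \in TT -> [disjoint F & T].
    by move=> TTT; apply: disjointWr dF; apply: bigcup_sup.
  have FTT : F \notin TT.
    by apply/negP => /dFT; rewrite -setI_eq0 setIid -cards_eq0 F3.
  have := TTmax (F |: TT); rewrite cardsU1 FTT add1n ltnn => /(_ _)/negP; apply; last by [].
  apply/andP; split.
    apply/trivIsetP => T1 T2 /setU1P[->|T1T] /setU1P[->|T2T] ne.
    + by rewrite eqxx in ne.
    + exact: dFT.
    + by rewrite disjoint_sym dFT.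
    + exact: (trivIsetP TTt).
  apply/forallP => T; apply/implyP => /setU1P[->|/TTok'[-> ->]] //.
  by rewrite Ft.
- by move=> M' M'G M't; apply: Mmax; rewrite /okM M'G.
Qed.

Lemma card_family_bound : #|S|%:R <= (2 / q) ^+ h.
Proof.
have := @clean_bound set0 set0; rewrite Z_set0 /budget !cards0 !expr0 !mulr1.
have -> : sat set0 set0 = S.
  by apply/setP => a; rewrite inE sub0set -setI_eq0 setI0 eqxx !andbT.
by apply; rewrite -setI_eq0 setI0.
Qed.
End Core.

(** * The models of a formula as a family of sets *)

Section Models.
Variables (n h : nat) (F : cnf n).
Hypothesis F3 : is_kcnf 3 F.
Hypothesis Fneg : negation_closed F.

Definition indicator (A : {set 'I_n}) : assignment n := [ffun i => i \in A].

Definition models := [set A : {set 'I_n} | satisfies (indicator A) F].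

Lemma models_compl A : A \in models -> ~: A \in models.
Proof.
rewrite !inE => /Fneg; congr satisfies.
by apply/ffunP => i; rewrite !ffunE inE.
Qed.

Hypothesis Fmin : forall A, A \in models -> (h <= #|A|)%N.

(** A model and its complement both have size at least [h], and their sizes add up to [2h]. *)
Lemma models_card : n = h.*2 -> forall A, A \in models -> #|A| = h.
Proof.
move=> nh A AS; have := Fmin AS; have := Fmin (models_compl AS).
have cE : (#|A| + #|~: A|)%N = h.*2 by rewrite cardsC card_ord.
move=> hA' hA; apply/eqP; rewrite eqn_leq hA andbT -(leq_add2r #|~: A|) cE -addnn.
by rewrite leq_add2l.
Qed.

(** The assignment with ones exactly in [A] is too light to be a model and falsifies a clause [C]. A
    model extending [A] cannot satisfy [C] through a negative literal, since those of [C] concern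
    variables of [A]. *)
Lemma models_hit (A B : {set 'I_n}) : (#|A| < h)%N -> exists T : {set 'I_n},
  [/\ (#|T| <= 3)%N, [disjoint T & A :|: B],
      forall a, a \in sat models A B -> ~~ [disjoint a & T]
    & #|T| = 3%N -> T \in triples models].
Proof.
move=> Ah; have nA : ~~ satisfies (indicator A) F.
  by apply/negP => AS; move: Ah; rewrite ltnNge Fmin // inE.
have /allPn[C CF /hasPn nC] := nA.
pose T := [set i | ((i, true) \in C) && (i \notin B)]; exists T.
have C3 : (#|[set l in C]| <= 3)%N.
  have := allP F3 C CF; apply: leq_trans.
  by rewrite cardsE; apply: card_size.
pose T' := [set (i, true) | i in T].
have cT : #|T'| = #|T| by apply: card_imset => i j [].
have TC : T' \subset [set l in C].
  by apply/subsetP => l /imsetP[i]; rewrite !inE => /andP[iC _] ->.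
have sat_clause (a : {set 'I_n}) : a \in models -> exists2 l, l \in C & lit_true (indicator a) l.
  by rewrite inE => /allP/(_ C CF)/hasP.
have TA : [disjoint T & A :|: B].
  apply/disjP => i; rewrite !inE => /andP[iC iB]; rewrite (negPf iB) orbF => iA.
  by have := nC _ iC; rewrite /lit_true ffunE /= iA eqxx.
split=> //; first by rewrite -cT (leq_trans (subset_leq_card TC)).
  move=> a /mem_satP[aS Aa aB]; have [[i b] lC] := sat_clause a aS.
  rewrite /lit_true ffunE /= => /eqP ib; rewrite -setI_eq0; apply/set0Pn; exists i.
  case: b lC ib => lC ia.
    by rewrite !inE ia lC /=; apply/negP; apply: (disjP _ _ aB).
  have := nC _ lC; rewrite /lit_true ffunE /=; case: (boolP (i \in A)) => // iA _.
  by rewrite (subsetP Aa) in ia.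
move=> T3; rewrite inE T3 eqxx /=; apply/forallP => a; apply/implyP => aS.
have [[i b] lC] := sat_clause a aS; rewrite /lit_true ffunE /= => /eqP ib.
(* Three variables in [T] leave no room in [C] for a literal other than their positive ones, so
   every model meets [T]. *)
have TE : T' = [set l in C] by apply/eqP; rewrite eqEcard TC cT T3.
have : (i, b) \in T' by rewrite TE inE.
case/imsetP => j jT [ij bt]; rewrite -setI_eq0; apply/set0Pn; exists i.
by rewrite inE ib bt ij jT.
Qed.
End Models.

Theorem mainTheorem3 (R : realType) (n : nat) (F : cnf n)
    (F_3cnf : is_kcnf 3 F)
    (F_min : ~ exists a : assignment n,
       satisfies a F /\ (hamming_weight a)%:R < n%:R / 2 :> R)
    (F_neg : negation_closed F) :
  #|[set a : assignment n |
       satisfies a F & (hamming_weight a)%:R == n%:R / 2 :> R]|%:R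
    <= (6 : R) `^ (n%:R / 4).
Proof.
set X := [set a | _ & _].
have halfP (m : nat) : (m%:R == n%:R / 2 :> R) = (m.*2 == n).
  have n2 : (2 : R) != 0 by rewrite pnatr_eq0.
  by rewrite -(inj_eq (mulIf n2)) divfK // -natrM muln2 eqr_nat.
(* The empty case includes all odd [n]; otherwise a member of [X] shows that [n = h.*2]. *)
have [a aX|X0] := pickP [in X]; last first.
  have -> : X = set0 by apply/setP => a; rewrite X0 inE.
  by rewrite cards0 powR_ge0.
have nh : n = (hamming_weight a).*2.
  by move: aX; rewrite inE halfP => /andP[_ /eqP].
move: (hamming_weight a) nh => h nh.
have Fmin A : A \in models F -> (h <= #|A|)%N.
  rewrite inE => AS; rewrite leqNgt; apply/negP => Ah; apply: F_min.
  exists (indicator A); split=> //.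
  have -> : hamming_weight (indicator A) = #|A|.
    by apply: eq_card => i; rewrite inE ffunE.
  have lt : (#|A| * 2 < n)%N by move: Ah nh; lia.
  by rewrite ltr_pdivlMr ?ltr0n // -natrM ltr_nat.
(* This is sqrt (2/3), written so that [2 / q] is visibly sqrt 6. *)
pose q : R := 2 / Num.sqrt 6.
have s0 : 0 < Num.sqrt 6 :> R by rewrite sqrtr_gt0.
have s2 : Num.sqrt 6 * Num.sqrt 6 = 6 :> R by rewrite -expr2 sqr_sqrtr.
have q0 : 0 < q by rewrite divr_gt0.
have qq : q * q = 2 / 3.
  by rewrite /q mulrACA -invfM s2; lra.
have cV : #|'I_n| = h.*2 by rewrite card_ord.
have bd := @card_family_bound _ h (models F) R q q0 qq cV (models_card F_neg Fmin nh)
  (@models_compl _ _ F_neg) (models_hit F_3cnf Fmin).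
have -> : (6 : R) `^ (n%:R / 4) = (2 / q) ^+ h.
  have -> : 2 / q = Num.sqrt 6 by rewrite /q invfM invrK mulrA divff ?pnatr_eq0 // mul1r.
  rewrite -powR12_sqrt // -powR_mulrn ?powR_ge0 // -powRrM; congr (_ `^ _).
  by rewrite nh -muln2 natrM; lra.
apply: le_trans bd; rewrite ler_nat.
have inj : injective (fun a : assignment n => [set i | a i]).
  by move=> a1 a2 /setP e; apply/ffunP => i; have := e i; rewrite !inE.
rewrite -(card_imset _ inj); apply: subset_leq_card; apply/subsetP => A /imsetP[b + ->].
rewrite !inE => /andP[bF _]; suff -> : indicator [set i | b i] = b by [].
by apply/ffunP => i; rewrite ffunE inE.
Qed.
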